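(* Let $N$ be a positive integer-valued random variable with $\mu=\mathbb{E}N<\infty$ and let $X_1,X_2,\dots$ be independent random variables, independent of $N$, with $\mathbb{E}X_i=0$ and $\mathbb{E}X_i^2=\sigma_i^2\in(0,\infty)$. Set $\sigma^2=\frac1\mu\mathbb{E}[\sum_{i=1}^N\sigma_i^2]$. Let $M$ be a positive integer-valued random variable, independent of the $X_i$, with $\mathbb{P}(M=m)=\frac{\sigma_m^2}{\mu\sigma^2}\mathbb{P}(N\ge m)$, $m\ge1$, where $(N,M)$ are defined jointly (and independently of the $X_i$). For each $i$ let $X_i^L$ have the $X_i$-centered equilibrium distribution, coupled with $X_i$, the pairs $(X_i,X_i^L)$ being independent across $i$ and of $(N,M)$. Let $W=\mu^{-1/2}\sum_{i=1}^NX_i$ and $Z\sim\mathrm{Laplace}(0,\sigma/\sqrt2)$. Then $$d_{\mathrm W}(W,Z)\le12\mu^{-1/2}\Big\{\mathbb{E}|X_M-X_M^L|+\sup_{i\ge1}\sigma_i\,\mathbb{E}\big[|N-M|^{1/2}\big]\Big\}.$$ If further $|X_i|\le C$ for all $i$ and $|N-M|\le K$ almost surely, then $$d_{\mathrm K}(W,Z)\le\frac{17.04}{\sigma\sqrt\mu}\Big\{\sup_{i\ge1}\|F_{X_i}^{-1}-F_{X_i^L}^{-1}\|+CK\Big\};$$ if $K=0$ (i.e. $N=M$), this last bound also holds without the boundedness assumption on the $X_i$.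
   Context: For $b>0$, $\mathrm{Laplace}(0,b)$ has density $\frac1{2b}e^{-|x|/b}$. For a mean-zero random variable $X$ with finite nonzero variance $s^2$, $X^L$ has the $X$-centered equilibrium distribution if $\mathbb{E}f(X)-f(0)=\frac12\mathbb{E}X^2\,\mathbb{E}f''(X^L)$ for all twice-differentiable $f$ for which the expectations exist (equivalently $\mathbb{E}Xg(X)=\frac{s^2}{2}\mathbb{E}[X^Lg''(X^L)+2g'(X^L)]$). For a random variable $X$, $F_X$ is its distribution function, $F_X^{-1}$ its generalized inverse, and $\|F_X^{-1}-F_Y^{-1}\|=\sup_{u\in(0,1)}|F_X^{-1}(u)-F_Y^{-1}(u)|$. $d_{\mathrm K}$ is the Kolmogorov distance and $d_{\mathrm W}$ the Wasserstein distance (sup over Lipschitz test functions with constant $\le1$). *)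

(* Defs.v *)
From HB Require Import structures.
From mathcomp Require Import all_boot all_order all_algebra.
From mathcomp Require Import all_classical all_reals all_analysis.
From mathcomp Require Import finmap.
Import Order.TTheory GRing.Theory Num.Theory.
Import numFieldNormedType.Exports.

Set Implicit Arguments.
Unset Strict Implicit.
Unset Printing Implicit Defensive.

Local Open Scope classical_set_scope.
Local Open Scope ring_scope.

Section defs.
Context {d : measure_display} {T : measurableType d} {R : realType}.

Definition laplace_pdf (b x : R) : R := (2 * b)^-1 * expR (- `|x| / b).

Definition lip1 (h : R -> R) : Prop := forall x y, `|h x - h y| <= `|x - y|.

Definition wasserstein_laplace (P : probability T R) (W : T -> R) (b : R) : \bar R :=
  ereal_sup [set `| (\int[P]_t (h (W t))%:E
                   - \int[lebesgue_measure]_x (h x * laplace_pdf b x)%:E)%E |%E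
            | h in lip1].

Definition kolmogorov_laplace (P : probability T R) (W : T -> R) (b : R) : \bar R :=
  ereal_sup [set `| (P [set t | (W t <= x)%R]
                   - \int[lebesgue_measure]_(y in [set y : R | (y <= x)%R]) (laplace_pdf b y)%:E)%E |%E
            | x in [set: R]].

Definition cdf (P : probability T R) (X : T -> R) (x : R) : R :=
  fine (P [set t | X t <= x]).
Definition qinv (P : probability T R) (X : T -> R) (u : R) : R :=
  inf [set x : R | u <= cdf P X x].
Definition qdist (P : probability T R) (X Y : T -> R) : \bar R :=
  ereal_sup [set (`|qinv P X u - qinv P Y u|)%:E | u in `]0, 1[%classic].

Definition equilibrium (P : probability T R) (X XL : T -> R) : Prop :=
  forall f : R -> R,
    (forall x, derivable f x 1) -> (forall x, derivable (derive1 f) x 1) ->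
    P.-integrable setT (EFin \o (f \o X)) ->
    P.-integrable setT (EFin \o (derive1 (derive1 f) \o XL)) ->
    (\int[P]_t (f (X t))%:E - (f 0)%:E
     = (2^-1)%:E * \int[P]_t (X t ^+ 2)%:E * \int[P]_t (derive1 (derive1 f) (XL t))%:E)%E.

Definition mutually_independent {I : choiceType} (P : probability T R)
    (G : I -> set (set T)) : Prop :=
  forall (J : {fset I}) (A : I -> set T), (forall j, j \in J -> G j (A j)) ->
    P (\bigcap_(j in [set` J]) A j) = (\prod_(j <- J) P (A j))%E.

Definition sigma_pair_R (X Y : T -> R) : set (set T) :=
  [set (fun t => (X t, Y t)) @^-1` B | B in @measurable _ (R * R)%type].

Definition sigma_pair_nat (N M : T -> nat) : set (set T) :=
  [set (fun t => (N t, M t)) @^-1` B | B in [set: set (nat * nat)]].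

End defs.

(* Main.v *)
Require Import Defs.
From HB Require Import structures.
From mathcomp Require Import all_boot all_order all_algebra.
From mathcomp Require Import all_classical all_reals all_analysis.
From mathcomp Require Import finmap measurable_realfun ring lra zify.
Import Order.TTheory GRing.Theory Num.Theory.
Import numFieldNormedType.Exports.

(** For a bounded continuous h, the function u(x) = E h(x + Z), with Z Laplace of
    scale b, solves u - b^2 u'' = h and satisfies u(0) = E h(Z). Writing S_n for the
    partial sums and a = mu^(-1/2), the variable W^L = a (S_(M-1) + X_M^L) has the
    W-centered equilibrium distribution: telescoping u(a S_N) over the indices up to N
    and applying the equilibrium identity of X_m to each increment produces the law of M.
    Hence E h(W^L) - E h(Z) = E u(W^L) - E u(W).

    If h is 1-Lipschitz then so is u, which gives d_W(W, Z) <= 2 E|W - W^L|; the right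
    side is bounded through W - W^L = a ((S_N - S_M) + (X_M - X_M^L)).

    If h is a nonincreasing ramp then u is nonincreasing and b^(-1)-Lipschitz. A bound on
    the distance of the quantile functions says that each of X_m, X_m^L is stochastically
    below the other up to a shift; this passes to W and W^L by conditioning on M and
    S_(M-1), and to E u(W), E u(W^L) because u is monotone, so no coupling of X_m and
    X_m^L has to be constructed. *)

Set Implicit Arguments.
Unset Strict Implicit.
Unset Printing Implicit Defensive.

Local Open Scope classical_set_scope.
Local Open Scope ring_scope.

(** The Laplace density of scale b is the Green function of 1 - b^2 D^2. Cutting the convolution at
    x gives two one-sided exponential averages, each solving a first-order equation; in u' the terms
    in h cancel, so u is twice differentiable although h is only continuous. M may depend on N in
    any way. The exchange of laws rests on the fact that, for fixed m, S_(m-1) and the pair (X_m,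
    X_m^L) are independent of (N, M): an event of (N, M) enters only through its probability, so {N
    >= m} can be traded for {M = m}. The telescoping is kept finite by cutting N to min(N, n), and n
    tends to infinity by bounded convergence; hence the test functions are bounded first, and
    unbounded Lipschitz functions are reached by clamping. The constants obtained are 2 and 2 sqrt
    2, below the stated 12 and 17.04. The 2 is one Lipschitz estimate for h and one for u. In the
    Kolmogorov bound a shift e costs e/b through the slope of u and 2e/(2b) through the height of
    the density, and b = sigma / sqrt 2. *)

(** * Invariance of Lebesgue integrals under translation and reflection *)

Section lebesgue_isometries.
Context {R : realType}.
Notation leb := (@lebesgue_measure R).

Lemma lebesgue_measure_shift (c : R) (A : set R) : measurable A ->
  leb ((fun x => x + c) @^-1` A) = leb A.
Proof.
move=> mA.
have mc : measurable_fun [set: measurableTypeR R]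
    ((fun x => x + c) : measurableTypeR R -> measurableTypeR R).
  exact: measurable_funD.
pose f : {mfun measurableTypeR R >-> measurableTypeR R} :=
  HB.pack ((fun x => x + c) : measurableTypeR R -> measurableTypeR R)
    (isMeasurableFun.Build _ _ _ _ _ mc).
change (pushforward leb f A = leb A).
apply/esym/lebesgue_measure_unique => //= _ [[a b]] _ <-.
rewrite /pushforward /=.
have -> : f @^-1` `]a, b] = `]a - c, b - c]%classic.
  by apply/seteqP; split => x /=; rewrite !in_itv/= ltrBlDr lerBrDr.
rewrite !lebesgue_measure_itv/= !lte_fin ltrD2r.
by case: ifP => // _; rewrite -!EFinD; congr EFin; lra.
Qed.

(** The image of Lebesgue measure under g is Lebesgue measure, so the change of variables has no
    Jacobian. Translations and the reflection are the two instances. *)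
Lemma Rintegral_comp_preserving (g f : R -> R) : measurable_fun setT g ->
  (forall A, measurable A -> leb (g @^-1` A) = leb A) ->
  leb.-integrable setT (EFin \o f) ->
  leb.-integrable setT (EFin \o (f \o g)) /\
  \int[leb]_x f (g x) = \int[leb]_x f x.
Proof.
move=> mg gleb fint.
have mg' : measurable_fun [set: measurableTypeR R]
  (g : measurableTypeR R -> measurableTypeR R) by exact: mg.
pose G : {mfun measurableTypeR R >-> measurableTypeR R} :=
  HB.pack (g : measurableTypeR R -> measurableTypeR R)
    (isMeasurableFun.Build _ _ _ _ _ mg').
have mf : measurable_fun setT f.
  by have /integrableP[/measurable_EFinP] := fint.
have pE (F : R -> \bar R) :
    (\int[pushforward leb G]_y F y = \int[leb]_y F y)%E.
  by apply: eq_measure_integral => /= A mA _; exact: gleb.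
have fgint : leb.-integrable setT (EFin \o (f \o g)).
  apply/integrableP; split; first exact/measurable_EFinP/measurableT_comp.
  have /integrableP[_] := fint; rewrite -pE ge0_integral_pushforward//.
  by apply: measurableT_comp => //; exact/measurable_EFinP.
split => //; rewrite /Rintegral -[in RHS]pE integral_pushforward//.
exact/measurable_EFinP.
Qed.

Lemma Rintegral_shift (c : R) (f : R -> R) : leb.-integrable setT (EFin \o f) ->
  leb.-integrable setT (EFin \o (fun x => f (x + c))) /\
  \int[leb]_x f (x + c) = \int[leb]_x f x.
Proof.
move=> fint; apply: (@Rintegral_comp_preserving (fun x => x + c)) => //.
  exact: measurable_funD.
by move=> A mA; rewrite lebesgue_measure_shift.
Qed.

Lemma Rintegral_opp (f : R -> R) : leb.-integrable setT (EFin \o f) ->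
  leb.-integrable setT (EFin \o (fun x => f (- x))) /\
  \int[leb]_x f (- x) = \int[leb]_x f x.
Proof.
move=> fint; apply: (@Rintegral_comp_preserving (fun x => - x)) => //.
  exact: oppr_measurable.
by move=> A mA; rewrite -[RHS]lebesgue_measureN.
Qed.

End lebesgue_isometries.

(** * The Laplace density and the solution u of u - b^2 u'' = h *)

Section laplace.
Context {R : realType}.
Notation leb := (@lebesgue_measure R).
Variable b : R.
Hypothesis b0 : 0 < b.
Notation p := (laplace_pdf b).

Lemma laplace_pdf_ge0 x : 0 <= p x.
Proof. by rewrite /laplace_pdf mulr_ge0 ?expR_ge0// invr_ge0 mulr_ge0// ltW. Qed.

Lemma laplace_pdf_le x : p x <= (2 * b)^-1.
Proof.
rewrite /laplace_pdf ler_piMr//; first by rewrite invr_ge0 mulr_ge0// ltW.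
by rewrite -expR0 ler_expR mulNr oppr_le0 divr_ge0 // ltW.
Qed.

Lemma laplace_pdfN x : p (- x) = p x.
Proof. by rewrite /laplace_pdf normrN. Qed.

Lemma continuous_laplace_pdf : continuous p.
Proof.
move=> x; apply: (@continuousM _ R^o (fun=> (2*b)^-1) (fun x => expR (- `|x| / b))).
  exact: cst_continuous.
apply: continuous_comp; last exact: continuous_expR.
apply: (@continuousM _ R^o (fun x => - `|x|) (fun=> b^-1)); last exact: cst_continuous.
by apply: (@continuousN _ R^o); exact: norm_continuous.
Qed.

Lemma measurable_laplace_pdf : measurable_fun setT p.
Proof. exact: continuous_measurable_fun continuous_laplace_pdf. Qed.

(** On the positive half-line the density is half the exponential density of rate 1/b, and symmetry
    gives the other half of the mass. *)
Lemma integral_laplace_pdf : (\int[leb]_x (p x)%:E = 1)%E.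
Proof.
have mp := measurable_laplace_pdf.
have half : (\int[leb]_(x in `[0%R, +oo[) (p x)%:E = (2^-1)%:E)%E.
  transitivity (\int[leb]_(x in `[0%R, +oo[) ((2^-1)%:E * (exponential_pdf b^-1 x)%:E))%E.
    apply: eq_integral => x /set_mem; rewrite /= in_itv/= andbT => x0.
    rewrite exponential_pdfE// /laplace_pdf ger0_norm// -EFinM; congr EFin.
    by rewrite invfM mulrA; congr (_ * expR _); rewrite mulNr mulrC mulNr.
  rewrite ge0_integralZl//=; first last.
  - by move=> x _; rewrite lee_fin exponential_pdf_ge0// invr_ge0 ltW.
  - by apply/measurable_EFinP; apply: measurable_funTS; apply: measurable_exponential_pdf.
  rewrite -[RHS]mule1; congr (_ * _)%E.
  have <- := @integral_exponential_pdf R b^-1; last by rewrite invr_gt0.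
  rewrite integral_mkcond; apply: eq_integral => x _.
  rewrite /exponential_pdf restrict_EFin /= !patchE.
  by case: ifP => // ->.
rewrite -(setUv `]-oo, 0%R]%classic) setCitvl/= ge0_integral_setU//=.
- rewrite integral_itv_obnd_cbnd ; last first.
    by apply/measurable_EFinP/measurable_funTS.
  rewrite half.
  have <- : (\int[leb]_(x in `]-oo, 0%R]) (p (- x))%:E)%E = (\int[leb]_(x in `]-oo, 0%R]) (p x)%:E)%E.
    by apply: eq_integral => x _; rewrite laplace_pdfN.
  rewrite -(@ge0_integration_by_substitution0 _ (fun x => (p x)%:E)) ?half//.
  + by rewrite -EFinD; congr EFin; lra.
  + exact/measurable_EFinP.
  + by move=> r; rewrite lee_fin laplace_pdf_ge0.
- by apply/measurable_EFinP/measurable_funTS.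
- by move=> x _; rewrite lee_fin laplace_pdf_ge0.
- by apply/disj_setPS => x /=; rewrite !in_itv/= andbT => -[/le_lt_trans h /h]; rewrite ltxx.
Qed.

Lemma integrable_laplace_pdf : leb.-integrable setT (EFin \o p).
Proof.
apply/integrableP; split; first by apply/measurable_EFinP; apply: measurable_laplace_pdf.
under eq_integral do rewrite gee0_abs ?lee_fin ?laplace_pdf_ge0//=.
by rewrite integral_laplace_pdf ltry.
Qed.

Lemma Rintegral_laplace_pdf : \int[leb]_x p x = 1.
Proof. by rewrite /Rintegral integral_laplace_pdf. Qed.

Lemma integrable_Mlaplace (h : R -> R) (c : R) : measurable_fun setT h ->
  (forall x, `|h x| <= c) -> leb.-integrable setT (EFin \o (fun y => h y * p y)).
Proof.
move=> mh hc.
have mp := measurable_laplace_pdf.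
apply: (@le_integrable _ _ _ leb _ measurableT _ (EFin \o (fun y => c * p y))).
- by apply/measurable_EFinP; apply: measurable_funM.
- move=> x _ /=; rewrite lee_fin !normrM; apply: ler_wpM2r => //.
  by rewrite (le_trans (hc x))// ler_norm.
- exact: (@integrableZl _ _ _ leb setT measurableT c _ integrable_laplace_pdf).
Qed.

Lemma integrable_Mlaplace_shift (h : R -> R) (c x : R) : measurable_fun setT h ->
  (forall x, `|h x| <= c) ->
  leb.-integrable setT (EFin \o (fun y => h y * p (y - x))).
Proof.
move=> mh hc.
have m1 : measurable_fun setT (fun y : R => h (y + x)).
  by apply: measurableT_comp => //; exact: measurable_funD.
have := (Rintegral_shift (- x) (@integrable_Mlaplace _ c m1 (fun y => hc _))).1.
by apply: eq_integrable => // y _ /=; rewrite subrK.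
Qed.

(** This is E h(x + Z), that is (1 - b^2 D^2)^(-1) h: the resolvent of the second derivative applied
    to h. *)
Definition laplace_resolvent (h : R -> R) (x : R) : R :=
  \int[leb]_z (h (x + z) * p z).

(** The part y <= x of the convolution of h with the density. The kernel is factored so that x
    occurs only in a prefactor and in the upper limit, which is the form differentiated below; the
    result L solves L + b L' = h/2. *)
Definition left_resolvent (h : R -> R) (x : R) : R :=
  (2 * b)^-1 * (expR (- x / b) *
    \int[leb]_(y in `]-oo, x]) (expR (y / b) * h y)).

Lemma integrable_expM (h : R -> R) (c x : R) : measurable_fun setT h ->
  (forall x, `|h x| <= c) ->
  leb.-integrable `]-oo, x] (EFin \o (fun y => expR (y / b) * h y)).
Proof.
move=> mh hc.
have mE : measurable_fun setT (fun y : R => expR (y / b) * h y).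
  by apply: measurable_funM => //; apply: measurableT_comp => //; exact: measurable_funM.
have := @integrable_Mlaplace_shift h c x mh hc.
(* For y <= x the shifted density is e^((y - x)/b) / (2b), so the factor 2b e^(x/b) turns it into
   e^(y/b). *)
move=> /(@integrableZl _ _ _ leb setT measurableT (2 * b * expR (x / b))).
move=> /(@integrableS _ _ _ leb _ `]-oo, x] _ measurableT).
move=> /(_ (measurable_itv _) (@subsetT _ _)).
apply: eq_integrable => //= y /set_mem; rewrite /= in_itv/= => yx.
rewrite /laplace_pdf ler0_norm ?subr_le0// opprK -EFinM; congr EFin.
rewrite mulrBl expRD expRN; field.
by rewrite gt_eqF ?expR_gt0//= gt_eqF.
Qed.

Lemma left_resolventE (h : R -> R) (c x : R) : measurable_fun setT h ->
  (forall x, `|h x| <= c) ->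
  left_resolvent h x = \int[leb]_(y in `]-oo, x]) (h y * p (y - x)).
Proof.
move=> mh hc; rewrite /left_resolvent mulrA -RintegralZl//; last exact: (@integrable_expM _ c).
apply: eq_Rintegral => y /set_mem; rewrite /= in_itv/= => yx.
rewrite /laplace_pdf ler0_norm ?subr_le0// opprK mulrBl expRD mulNr.
by ring.
Qed.

(** The convolution is cut at x, and the reflection y -> -y turns the right part into a left part
    for [h \o -%R], so only one half has to be differentiated. *)
Lemma laplace_resolventE (h : R -> R) (c x : R) : measurable_fun setT h ->
  (forall x, `|h x| <= c) ->
  laplace_resolvent h x = left_resolvent h x + left_resolvent (h \o -%R) (- x).
Proof.
move=> mh hc.
have I1 := @integrable_Mlaplace_shift h c x mh hc.
rewrite /laplace_resolvent.
have -> : \int[leb]_z (h (x + z) * p z) = \int[leb]_y (h y * p (y - x)).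
  rewrite -(Rintegral_shift x I1).2; apply: eq_Rintegral => y _.
  by rewrite addrK addrC.
have mhN : measurable_fun setT (h \o -%R).
  by apply: measurableT_comp => //; exact: oppr_measurable.
rewrite (left_resolventE _ mh hc) (left_resolventE _ mhN (fun y => hc _)).
transitivity (\int[leb]_(y in `]-oo, x] `|` ~` `]-oo, x]) (h y * p (y - x))).
  by rewrite setUv.
rewrite Rintegral_setU; last 4 first.
- exact: measurable_itv.
- exact: measurableC.
- by rewrite setUv; exact: I1.
- by apply/disj_setPS => y /= [].
congr (_ + _).
rewrite setCitvl Rintegral_mkcond.
have I2 : leb.-integrable setT
    (EFin \o ((fun y => h y * p (y - x)) \_ `]x, +oo[)).
  have /= := (@integrable_mkcond _ _ _ leb `]x, +oo[
    (EFin \o (fun y => h y * p (y - x))) (measurable_itv _)).1.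
  rewrite restrict_EFin; apply.
  by apply: integrableS I1 => //.
rewrite -(Rintegral_opp I2).2.
(* The reflection of ]x, +oo[ is the open half-line below -x; the endpoint is a null set. *)
rewrite -Rintegral_itv_bndo_bndc; last first.
  have := @integrable_Mlaplace_shift _ c (- x) mhN (fun y => hc _).
  by apply: integrableS.
rewrite [RHS]Rintegral_mkcond; apply: eq_Rintegral => y _.
rewrite !patchE !mem_setE !in_itv/= andbT ltrNr.
by case: ifP => // _; rewrite -[in LHS]laplace_pdfN opprB opprK addrC opprK.
Qed.

Lemma is_derive_left_resolvent (h : R -> R) (c x : R) : continuous h ->
  (forall x, `|h x| <= c) ->
  is_derive x 1 (left_resolvent h) ((2 * b)^-1 * h x - b^-1 * left_resolvent h x).
Proof.
move=> ch hc.
have mh : measurable_fun setT h by exact: continuous_measurable_fun.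
pose G x := \int[leb]_(y in `]-oo, x]) (expR (y / b) * h y).
have cE : continuous (fun y : R => expR (y / b)).
  move=> y; apply: continuous_comp; last exact: continuous_expR.
  by apply: (@continuousM _ R^o (fun x => x) (fun=> b^-1)) => //; exact: cst_continuous.
have dG : is_derive x 1 G (expR (x / b) * h x).
  (* The bound [x + 1] is an arbitrary point beyond x; it makes x interior to the half-line of
     integration. *)
  have [||||dG G'] := @continuous_FTC1 R (fun y => expR (y / b) * h y) -oo%O x (x + 1).
  - by rewrite ltrDl.
  - exact: (@integrable_expM _ c).
  - by rewrite ltNyr.
  - by apply: (@continuousM _ R^o (fun y => expR (y / b)) h); [exact: cE|exact: ch].
  by apply: DeriveDef; [exact: dG|rewrite -derive1E; exact: G'].
have dE : is_derive x 1 (fun y => expR (- y / b)) (- b^-1 * expR (- x / b)).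
  have d1 : is_derive x 1 (fun y : R => - y / b) (- b^-1).
    have := is_deriveZ (- b^-1) (is_derive_id x (1 : R)).
    rewrite /GRing.scale/= mulr1; congr is_derive.
    by apply/funext => y; change (- b^-1 * y = - y / b); ring.
  have := @is_derive1_comp R expR (fun y => - y / b) x _ _ (is_derive_expR _) d1.
  by move=> /is_derive_eq; apply; rewrite mulrC.
have := is_deriveZ (2 * b)^-1 (is_deriveM dE dG).
move=> /is_derive_eq; apply.
rewrite /left_resolvent /= /GRing.scale /= -/(G x).
rewrite !mulNr expRN; field.
by rewrite gt_eqF ?expR_gt0//= gt_eqF.
Qed.

Section resolvent.
Variables (h : R -> R) (c : R).
Hypotheses (ch : continuous h) (hc : forall x, `|h x| <= c).

Let mh : measurable_fun setT h.
Proof. exact: continuous_measurable_fun. Qed.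

Let u := laplace_resolvent h.

Let v (x : R) := left_resolvent (h \o -%R) (- x).

Let uE : u = fun x => left_resolvent h x + v x.
Proof. by apply/funext => x; rewrite /u (laplace_resolventE _ mh hc). Qed.

Let is_derive_v (x : R) : is_derive x 1 v (b^-1 * v x - (2 * b)^-1 * h x).
Proof.
have chN : continuous (h \o -%R).
  by move=> y; apply: continuous_comp; [exact: (@continuousN _ R^o)|exact: ch].
have := @is_derive1_comp R _ -%R x _ _
  (is_derive_left_resolvent (- x) chN (fun y => hc _)) (is_deriveNid x 1).
by move=> /is_derive_eq; apply; rewrite /= opprK mulrN1 opprB.
Qed.

(** The two halves contribute h/(2b) with opposite signs, so u' = (v - L)/b contains no explicit h.
    Both the second derivative and the Lipschitz bound for u start from this formula. *)
Lemma is_derive_laplace_resolvent (x : R) :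
  is_derive x 1 u (b^-1 * (v x - left_resolvent h x)).
Proof.
rewrite uE.
have := is_deriveD (is_derive_left_resolvent x ch hc) (is_derive_v x).
by move=> /is_derive_eq; apply; ring.
Qed.

(** In v' - L' the terms in h add up instead of cancelling, giving (v + L - h)/b = (u - h)/b; this
    is the differential equation of u. *)
Lemma is_derive2_laplace_resolvent (x : R) :
  is_derive x 1 (derive1 u) (b ^- 2 * (u x - h x)).
Proof.
have -> : (derive1 u) = fun x => b^-1 * (v x - left_resolvent h x).
  apply/funext => y; rewrite derive1E.
  by have [] := is_derive_laplace_resolvent y.
have := is_deriveZ b^-1 (is_deriveB (is_derive_v x) (is_derive_left_resolvent x ch hc)).
move=> /is_derive_eq; apply.
rewrite /GRing.scale/= uE; field.
by rewrite gt_eqF.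
Qed.

Lemma derivable_laplace_resolvent (x : R) : derivable u x 1.
Proof. by have [] := is_derive_laplace_resolvent x. Qed.

Lemma derivable2_laplace_resolvent (x : R) : derivable (derive1 u) x 1.
Proof. by have [] := is_derive2_laplace_resolvent x. Qed.

Lemma continuous_laplace_resolvent : continuous u.
Proof.
move=> x; apply: differentiable_continuous.
exact/derivable1_diffP/derivable_laplace_resolvent.
Qed.

Let integrable_shift x : leb.-integrable setT (EFin \o (fun z => h (x + z) * p z)).
Proof.
apply: (@integrable_Mlaplace (fun z => h (x + z)) c) => //.
by apply: measurableT_comp => //; exact: measurable_funD.
Qed.

Lemma laplace_resolvent0 : u 0 = \int[leb]_z (h z * p z).
Proof. by apply: eq_Rintegral => z _; rewrite add0r. Qed.

Lemma le_laplace_resolvent x : `|u x| <= c.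
Proof.
rewrite (le_trans (le_normr_Rintegral measurableT (integrable_shift x)))//.
rewrite -[leRHS]mulr1 -Rintegral_laplace_pdf -RintegralZl//; last exact: integrable_laplace_pdf.
apply: le_Rintegral => //.
- exact: integrable_norm.
- exact: (@integrableZl _ _ _ leb setT measurableT c _ integrable_laplace_pdf).
- move=> z _; rewrite normrM (ger0_norm (laplace_pdf_ge0 z)).
  by apply: ler_wpM2r; rewrite ?laplace_pdf_ge0.
Qed.

Lemma laplace_resolvent_ge0 x : (forall y, 0 <= h y) -> 0 <= u x.
Proof.
by move=> h0; apply: Rintegral_ge0 => z _; rewrite mulr_ge0 ?laplace_pdf_ge0.
Qed.

Lemma laplace_resolvent_lip1 : lip1 h -> lip1 u.
Proof.
move=> hl x y; rewrite /u /laplace_resolvent -RintegralB//.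
rewrite (le_trans (le_normr_Rintegral measurableT _))//.
  exact: (integrableB measurableT (integrable_shift x) (integrable_shift y)).
rewrite -[leRHS]mulr1 -Rintegral_laplace_pdf -RintegralZl//; last exact: integrable_laplace_pdf.
apply: le_Rintegral => //.
- apply: integrable_norm.
  exact: (integrableB measurableT (integrable_shift x) (integrable_shift y)).
- exact: (@integrableZl _ _ _ leb setT measurableT _ _ integrable_laplace_pdf).
- move=> z _; rewrite -mulrBl normrM (ger0_norm (laplace_pdf_ge0 z)).
  apply: ler_wpM2r; rewrite ?laplace_pdf_ge0//.
  by rewrite (le_trans (hl _ _))// opprD addrACA subrr addr0.
Qed.

Lemma laplace_resolvent_nonincreasing :
  {homo h : x y / x <= y >-> y <= x} -> {homo u : x y / x <= y >-> y <= x}.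
Proof.
move=> hh x y xy; apply: le_Rintegral => // z _.
by apply: ler_wpM2r; rewrite ?laplace_pdf_ge0// hh// lerD2r.
Qed.

End resolvent.

Lemma left_resolvent_ge0 (h : R -> R) x : (forall x, 0 <= h x) -> 0 <= left_resolvent h x.
Proof.
move=> h0; rewrite /left_resolvent !mulr_ge0 ?expR_ge0 ?invr_ge0 ?mulr_ge0//.
  exact: ltW.
by apply: Rintegral_ge0 => y _; rewrite mulr_ge0 ?expR_ge0.
Qed.

(** Both halves v and L are nonnegative with sum u <= 1, so |u'| = |v - L|/b <= 1/b. The slope of h
    does not enter, so a ramp may be arbitrarily steep. *)
Lemma laplace_resolvent_lipschitz (h : R -> R) : continuous h ->
  (forall x, 0 <= h x <= 1) -> forall x y,
  `|laplace_resolvent h x - laplace_resolvent h y| <= b^-1 * `|x - y|.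
Proof.
move=> ch h01 x y.
have h0 z : 0 <= h z by case/andP: (h01 z).
have h1 z : `|h z| <= 1 by rewrite ger0_norm//; case/andP: (h01 z).
wlog xy : x y / x <= y.
  by move=> H; have [/H//|/ltW/H] := leP x y; rewrite distrC (distrC y).
have [|z _] := MVT_segment xy (fun z _ => is_derive_laplace_resolvent ch h1 z).
  by apply: continuous_subspaceT; exact: (continuous_laplace_resolvent ch h1).
rewrite distrC (distrC x) => ->; rewrite normrM ler_wpM2r//.
rewrite normrM ger0_norm ?invr_ge0; last exact: ltW.
rewrite ler_piMr ?invr_ge0//; first exact: ltW.
have := le_trans (ler_norm _) (le_laplace_resolvent ch h1 z).
have mh : measurable_fun setT h by exact: continuous_measurable_fun.
rewrite (laplace_resolventE _ mh h1).
have := left_resolvent_ge0 z h0.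
have := @left_resolvent_ge0 (h \o -%R) (- z) (fun y => h0 _).
by rewrite ler_norml => *; lra.
Qed.

End laplace.

(** * Integration against independent variables on an event *)

Section independence.
Context {d : measure_display} {T : measurableType d} {R : realType}.
Variable P : probability T R.
Context {d1 d2 : measure_display} {T1 : measurableType d1} {T2 : measurableType d2}.
Variables (A : set T) (U : T -> T1) (V : T -> T2).
Hypotheses (mA : measurable A) (mU : measurable_fun setT U) (mV : measurable_fun setT V).
Hypothesis AUV : forall B D, measurable B -> measurable D ->
  P (A `&` U @^-1` B `&` V @^-1` D) = (P (A `&` U @^-1` B) * P (V @^-1` D))%E.

Let V' : {mfun T >-> T2} := HB.pack V (isMeasurableFun.Build _ _ _ _ _ mV).

Let m1 : {measure set T1 -> \bar R} :=
  measure_function_pushforward__canonical__measure_function_Measure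
    (mrestr P mA) mU.

Let m1_fin : fin_num_fun m1.
Proof.
move=> B mB; rewrite /m1 /= /pushforward /mrestr; apply: fin_num_measure.
by apply: measurableI => //; rewrite -[X in measurable X]setTI; exact: mU.
Qed.

Let m1' : {finite_measure set T1 -> \bar R} :=
  HB.pack (Measure.sort m1) m1 (Measure_isFinite.Build _ _ _ m1 m1_fin).

Let m2 := distribution P V'.

Let integral_mrestr (f : T -> \bar R) : measurable_fun setT f -> (forall t, 0 <= f t)%E ->
  (\int[mrestr P mA]_t f t = \int[P]_(t in A) f t)%E.
Proof.
move=> mf f0.
have mAC : measurable (~` A) by exact: measurableC.
transitivity (\int[mrestr P mA]_(t in A `|` ~` A) f t)%E; first by rewrite setUv.
rewrite ge0_integral_setU//.
- rewrite [X in (_ + X)%E]null_set_integral ?adde0//.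
  + by apply: eq_measure_integral => E mE EA; rewrite /= /mrestr (setIidl EA).
  + exact: measurable_funTS.
  + by rewrite /= /mrestr setICl measure0.
- exact: measurable_funTS.
- by apply/disj_setPS => y /= [].
Qed.

(** By [AUV], the law of (U, V) under P restricted to A agrees on rectangles with the product of a
    finite measure, the law of U on A, and the law of V. Uniqueness of the product measure and
    Tonelli finish. The event A is meant to fix the values of the random indices. *)
Lemma ge0_indep_integral (g : T1 * T2 -> \bar R) : measurable_fun setT g ->
  (forall x, 0 <= g x)%E ->
  (\int[P]_(t in A) g (U t, V t) = \int[P]_(t in A) \int[P]_s g (U t, V s))%E.
Proof.
move=> mg g0.
have mUV := measurable_fun_pair mU mV.
rewrite -(integral_mrestr (measurableT_comp mg mUV)); last by move=> t; exact: g0.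
rewrite -(ge0_integral_pushforward mUV (mrestr P mA) measurableT mg)//=.
transitivity (\int[m1' \x m2]_x g x)%E.
  apply: eq_measure_integral => E mE _; apply/esym.
  apply: (@product_measure_unique _ _ _ _ _ m1' m2
    (measure_function_pushforward__canonical__measure_function_Measure (mrestr P mA) mUV)) => //.
  move=> B D mB mD; rewrite /= /m2 /distribution /= /pushforward /mrestr.
  have -> : (fun t => (U t, V t)) @^-1` (B `*` D) = U @^-1` B `&` V @^-1` D by [].
  by rewrite setIC setIA AUV// setIC.
rewrite fubini_tonelli1//=.
have mF := @measurable_fun_fubini_tonelli_F _ _ _ _ _ m2 _ mg g0.
have F0 x : (0 <= fubini_F m2 g x)%E by apply: integral_ge0.
rewrite (ge0_integral_pushforward mU (mrestr P mA) measurableT mF)//=.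
rewrite integral_mrestr//; last exact: measurableT_comp.
apply: eq_integral => t _ /=; rewrite /fubini_F.
have mgt : measurable_fun setT (fun y => g (U t, y)) by apply: measurableT_comp.
by rewrite /m2 /distribution (ge0_integral_pushforward mV P measurableT mgt).
Qed.

Lemma ge0_indep_measurable (g : T1 * T2 -> \bar R) : measurable_fun setT g ->
  (forall x, 0 <= g x)%E -> measurable_fun setT (fun u => \int[P]_s g (u, V s))%E.
Proof.
move=> mg g0.
have := @measurable_fun_fubini_tonelli_F _ _ _ _ _ m2 _ mg g0.
congr (measurable_fun setT _); apply/funext => u; rewrite /fubini_F.
have mgt : measurable_fun setT (fun y => g (u, y)) by apply: measurableT_comp.
by rewrite /m2 /distribution (ge0_integral_pushforward mV P measurableT mgt).
Qed.

End independence.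

(** * The same for bounded real functions *)

Section bounded.
Context {d : measure_display} {T : measurableType d} {R : realType}.
Variable P : probability T R.

Lemma probability_Rintegral_cst (c : R) : \int[P]_t c = c.
Proof.
rewrite /Rintegral integral_cst// -[RHS]/(fine c%:E) -[in RHS](mule1 c%:E).
by congr (fine (_ * _)); exact: probability_setT.
Qed.

Lemma bounded_integrable (A : set T) (f : T -> R) (c : R) : measurable A ->
  measurable_fun setT f -> (forall t, `|f t| <= c) ->
  P.-integrable A (EFin \o f).
Proof.
move=> mA mf fc; apply: measurable_bounded_integrable => //.
- by rewrite (le_lt_trans (probability_le1 P mA))// ltry.
- exact: measurable_funTS.
- by exists c; split; [exact: num_real|] => y cy t _ /=; rewrite (le_trans (fc t))// ltW.
Qed.

Lemma Rintegral_bound (A : set T) (f : T -> R) (c : R) : measurable A ->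
  measurable_fun setT f -> (forall t, `|f t| <= c) ->
  `|\int[P]_(t in A) f t| <= c.
Proof.
move=> mA mf fc.
have fi := bounded_integrable mA mf fc.
rewrite (le_trans (le_normr_Rintegral mA fi))//.
have c0 : 0 <= c by rewrite (le_trans _ (fc point)).
apply: (@le_trans _ _ (\int[P]_(t in A) c)).
  apply: le_Rintegral => //; first exact: integrable_norm.
  by apply: (@bounded_integrable _ (cst c) c) => // t; rewrite ger0_norm.
rewrite Rintegral_cst// ler_piMr// -lee_fin fineK ?fin_num_measure//.
exact: probability_le1.
Qed.

(** Adding c makes g nonnegative, so the Tonelli version applies to g + c; the integral of c over A
    is then cancelled on both sides. *)
Lemma indep_Rintegral {d1 d2 : measure_display} {T1 : measurableType d1}
    {T2 : measurableType d2} (A : set T) (U : T -> T1) (V : T -> T2)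
    (g : T1 * T2 -> R) (c : R) :
  measurable A -> measurable_fun setT U -> measurable_fun setT V ->
  (forall B D, measurable B -> measurable D ->
    P (A `&` U @^-1` B `&` V @^-1` D) = (P (A `&` U @^-1` B) * P (V @^-1` D))%E) ->
  measurable_fun setT g -> (forall x, `|g x| <= c) ->
  measurable_fun setT (fun u => \int[P]_s g (u, V s)) /\
  \int[P]_(t in A) g (U t, V t) = \int[P]_(t in A) \int[P]_s g (U t, V s).
Proof.
move=> mA mU mV AUV mg gc.
have mgc : measurable_fun setT (fun x => (g x + c)%:E).
  by apply/measurable_EFinP; exact: measurable_funD.
have gc0 x : (0 <= (g x + c)%:E)%E.
  by rewrite lee_fin; have := gc x; rewrite ler_norml => /andP[? _]; lra.
have mgu u : measurable_fun setT (fun s => g (u, V s)).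
  by apply: measurableT_comp => //; exact: measurableT_comp.
have cint (B : set T) : measurable B -> P.-integrable B (EFin \o cst c).
  by move=> mB; apply: (@bounded_integrable _ _ `|c|).
have Ec u : \int[P]_s (g (u, V s) + c) = \int[P]_s g (u, V s) + c.
  rewrite RintegralD//; last 2 first.
  - exact: (@bounded_integrable _ _ c).
  - exact: cint.
  by rewrite probability_Rintegral_cst.
have mF : measurable_fun setT (fun u => \int[P]_s g (u, V s)).
  have := ge0_indep_measurable P mV mgc gc0.
  move=> /(measurableT_comp (fine_measurable measurableT)) H.
  rewrite [X in measurable_fun _ X](_ : _ = fun u => \int[P]_s (g (u, V s) + c) - c).
    by apply: measurable_funB => //; exact: H.
  by apply/funext => u; rewrite Ec addrK.
split => //.
have gint u : P.-integrable setT (EFin \o (fun s => g (u, V s) + c)).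
  apply: (@bounded_integrable _ _ (c + `|c|)) => //; first exact: measurable_funD.
  by move=> t; rewrite (le_trans (ler_normD _ _))// lerD2r.
have := @ge0_indep_integral _ _ _ P _ _ _ _ A U V mA mU mV AUV _ mgc gc0.
under [X in _ = X -> _]eq_integral => t _.
  rewrite (_ : (\int[P]_s _)%E = (\int[P]_s g (U t, V s) + c)%:E); last first.
    by rewrite -Ec /Rintegral fineK//; exact: (integrable_fin_num measurableT (gint (U t))).
  over.
move=> /(congr1 fine); rewrite -/(Rintegral P A (fun t => g (U t, V t) + c)).
rewrite -/(Rintegral P A (fun t => \int[P]_s g (U t, V s) + c)).
rewrite !RintegralD//; [move=> /addIr//|..].
- apply: (@bounded_integrable _ _ c) => //; first exact: (measurableT_comp mF mU).
  by move=> t; apply: Rintegral_bound.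
- exact: cint.
- apply: (@bounded_integrable _ _ c) => //.
  by apply: measurableT_comp => //; exact: measurable_fun_pair.
- exact: cint.
Qed.

End bounded.

(** * Independence of an event and a variable *)

Section event_independence.
Context {d : measure_display} {T : measurableType d} {R : realType}.
Variable P : probability T R.
Context {d2 : measure_display} {T2 : measurableType d2}.
Variables (A : set T) (V : T -> T2).
Hypotheses (mA : measurable A) (mV : measurable_fun setT V).
Hypothesis AV : forall D, measurable D ->
  P (A `&` V @^-1` D) = (P A * P (V @^-1` D))%E.

(** Taking U constant reduces the previous setting to an event and a variable: the preimages under U
    are empty or everything. *)
Let cstAV (B : set R) D : measurable B -> measurable D ->
  P (A `&` (cst 0%R : T -> R) @^-1` B `&` V @^-1` D) = (P (A `&` (cst 0%R : T -> R) @^-1` B) * P (V @^-1` D))%E.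
Proof.
move=> mB mD; rewrite preimage_cst; case: ifP => _.
  by rewrite setIT AV.
by rewrite setI0 set0I measure0 mul0e.
Qed.

Lemma ge0_event_indep_integral (g : T2 -> \bar R) : measurable_fun setT g ->
  (forall x, 0 <= g x)%E ->
  (\int[P]_(t in A) g (V t) = P A * \int[P]_t g (V t))%E.
Proof.
move=> mg g0.
have := @ge0_indep_integral _ _ _ P _ _ R _ A (cst 0) V mA (measurable_cst _) mV
  cstAV (g \o snd) (measurableT_comp mg measurable_snd) (fun x => g0 x.2).
by move=> /= ->; rewrite integral_cst// muleC.
Qed.

Lemma event_indep_Rintegral (g : T2 -> R) (c : R) : measurable_fun setT g ->
  (forall x, `|g x| <= c) ->
  \int[P]_(t in A) g (V t) = fine (P A) * \int[P]_t g (V t).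
Proof.
move=> mg gc.
have [_] := @indep_Rintegral _ _ _ P _ _ R _ A (cst 0) V (g \o snd) c mA
  (measurable_cst _) mV cstAV (measurableT_comp mg measurable_snd) (fun x => gc x.2).
by move=> ->; rewrite /= Rintegral_cst// mulrC.
Qed.

End event_independence.

(** * Integer-valued random indices *)

Section discrete.
Context {d : measure_display} {T : measurableType d} {R : realType}.

Lemma measurable_preimage_pair_nat (N M : T -> nat) :
  (forall n, measurable (N @^-1` [set n])) ->
  (forall n, measurable (M @^-1` [set n])) ->
  forall B : set (nat * nat), measurable ((fun t => (N t, M t)) @^-1` B).
Proof.
move=> mN mM B.
rewrite (_ : _ @^-1` _ = \bigcup_n \bigcup_(m in [set m | B (n, m)])
    (N @^-1` [set n] `&` M @^-1` [set m])).
  by do 2 (apply: bigcup_measurable => ? _); exact: measurableI.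
apply/seteqP; split => [t /= Bt|t [n _ [m /= Bnm [/= -> ->]]]//].
by exists (N t) => //; exists (M t).
Qed.

Lemma measurable_preimage_nat (N : T -> nat) :
  (forall n, measurable (N @^-1` [set n])) ->
  forall B : set nat, measurable (N @^-1` B).
Proof.
move=> mN B.
exact: (measurable_preimage_pair_nat mN mN (fst @^-1` B)).
Qed.

Lemma measurable_fun_nat_index {d'} {T' : measurableType d'} (N : T -> nat)
    (F : nat -> T -> T') :
  (forall n, measurable (N @^-1` [set n])) ->
  (forall n, measurable_fun setT (F n)) ->
  measurable_fun setT (fun t => F (N t) t).
Proof.
move=> mN mF _ B mB; rewrite setTI.
rewrite (_ : _ @^-1` _ = \bigcup_n (N @^-1` [set n] `&` F n @^-1` B)).
  apply: bigcup_measurable => n _; apply: measurableI => //.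
  by rewrite -[X in measurable X]setTI; exact: mF.
apply/seteqP; split => [t /= Bt|t [n _ [/= -> ]]//].
by exists (N t).
Qed.

(** The countably many levels of N partition the space, so a bound obtained for each fixed value of
    N integrates; nonnegativity replaces any integrability assumption. *)
Lemma le_integral_levels (P : probability T R) (N : T -> nat) (f g : T -> \bar R) :
  (forall n, measurable (N @^-1` [set n])) ->
  measurable_fun setT f -> measurable_fun setT g ->
  (forall t, 0 <= f t)%E -> (forall t, 0 <= g t)%E ->
  (forall n, \int[P]_(t in N @^-1` [set n]) f t <=
     \int[P]_(t in N @^-1` [set n]) g t)%E ->
  (\int[P]_t f t <= \int[P]_t g t)%E.
Proof.
move=> mN mf mg f0 g0 fg.
have TN : setT = \bigcup_n (N @^-1` [set n]).
  by apply/seteqP; split => // t _; exists (N t).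
have tN : trivIset setT (fun n => N @^-1` [set n]).
  by apply/trivIsetP => i j _ _ ij; apply/seteqP; split => // t /= [-> /eqP]; rewrite (negbTE ij).
rewrite TN !ge0_integral_bigcup//.
- by apply: lee_nneseries => // n _ *; exact: integral_ge0.
- by rewrite -TN.
- by rewrite -TN.
Qed.

End discrete.

(** * Independence of partial sums from later terms and from the indices *)

Section random_sum.
Context {d : measure_display} {T : measurableType d} {R : realType}.
Variables (P : probability T R) (N M : T -> nat) (X XL : nat -> T -> R).
Hypotheses (mN : forall n, measurable (N @^-1` [set n]))
  (mM : forall n, measurable (M @^-1` [set n]))
  (mX : forall i, measurable_fun setT (X i))
  (mXL : forall i, measurable_fun setT (XL i)).
(** The summation indices start at 1, so [Some i] carries the pair with index [i.+1]; [None] carries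
    the two random indices. *)
Let G (o : option nat) := match o with
     | None => sigma_pair_nat N M
     | Some i => sigma_pair_R (X i.+1) (XL i.+1)
     end.
Hypothesis ind : mutually_independent P G.

(** The range is half-open: [psum 1 n.+1] is S_n and [psum 1 n] is S_(n-1). *)
Definition psum (k n : nat) (t : T) : R := \sum_(k <= i < n) X i t.

Lemma measurable_psum k n : measurable_fun setT (psum k n).
Proof. by apply: measurable_sum. Qed.

Lemma psum_geq k n : (n <= k)%N -> psum k n = cst 0.
Proof. by move=> nk; apply/funext => t; rewrite /psum big_geq. Qed.

Lemma psumS k n t : (k <= n)%N -> psum k n.+1 t = psum k n t + X n t.
Proof. by move=> kn; rewrite /psum big_nat_recr. Qed.

Let mG o A : G o A -> measurable A.
Proof.
case: o => [i|] /= [B mB <-].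
  by rewrite -[X in measurable X]setTI; apply: measurable_fun_pair.
exact: measurable_preimage_pair_nat.
Qed.

Let mGJ (J : {fset option nat}) (A : option nat -> set T) :
  (forall j, j \in J -> G j (A j)) -> measurable (\bigcap_(j in [set` J]) A j).
Proof.
move=> GA; apply: fin_bigcap_measurable; first exact: finite_fset.
by move=> j /= /GA/mG.
Qed.

(** Induction on n. The family J is left arbitrary because, to split off the last summand, an event
    of that summand is moved into J before the induction hypothesis is used. *)
Lemma psum_indep k n (J : {fset option nat}) (A : option nat -> set T) B :
  (0 < k)%N -> (forall j, j \in J -> G j (A j)) ->
  (forall i, Some i \in J -> (n <= i.+1)%N) -> measurable B ->
  P (psum k n @^-1` B `&` \bigcap_(j in [set` J]) A j) =
  (P (psum k n @^-1` B) * \prod_(j <- J) P (A j))%E.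
Proof.
move=> k0; elim: n J A B => [|n IH] J A B GA Jn mB.
  rewrite psum_geq// preimage_cst; case: ifP => _.
    rewrite setTI ind//.
    rewrite [X in (X * _)%E](_ : _ = 1%E) ?mul1e//; exact: probability_setT.
  by rewrite set0I measure0 mul0e.
have [nk|kn] := ltnP n k.
  rewrite (_ : psum k n.+1 = psum k n); last by rewrite !psum_geq// ltnW.
  by apply: IH => // i /Jn/ltnW.
case: n IH Jn kn => [_ _|n IH Jn kn]; first by rewrite leqNgt k0.
pose F u : \bar R := (\int[P]_s (\1_B (u + X n.+1 s))%:E)%E.
have m1B : measurable_fun setT (fun x : R * R => (\1_B (x.1 + x.2))%:E : \bar R).
  apply/measurable_EFinP; apply: measurableT_comp => //; exact: measurable_funD.
have mF : measurable_fun setT F.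
  by apply: (ge0_indep_measurable P (mX n.+1) m1B) => x; rewrite lee_fin.
have F0 u : (0 <= F u)%E by apply: integral_ge0 => s _; rewrite lee_fin.
(* For J' empty the formula evaluates P(S in B) as the same integral of F, so factoring that
   integral out is enough. *)
suff key (J' : {fset option nat}) (A' : option nat -> set T) :
    (forall j, j \in J' -> G j (A' j)) ->
    (forall i, Some i \in J' -> (n.+1 < i.+1)%N) ->
    P (psum k n.+2 @^-1` B `&` \bigcap_(j in [set` J']) A' j) =
    ((\prod_(j <- J') P (A' j)) * \int[P]_t F (psum k n.+1 t))%E.
  have := key fset0 (fun=> setT); rewrite set_fset0 bigcap_set0 setIT.
  rewrite big_seq_fset0 mul1e => -> //.
  by rewrite muleC; exact: key.
move=> {GA Jn J A} GA Jn; move: J' A' GA Jn => J A GA Jn.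
set Q := \bigcap_(j in [set` J]) A j.
have mQ : measurable Q by exact: mGJ.
have IHJ B' : measurable B' ->
    P (psum k n.+1 @^-1` B' `&` Q) = (P (psum k n.+1 @^-1` B') * P Q)%E.
  by move=> mB'; rewrite /Q ind// IH// => i /Jn/ltnW.
have QUV B' D : measurable B' -> measurable D ->
    P (Q `&` psum k n.+1 @^-1` B' `&` X n.+1 @^-1` D) =
    (P (Q `&` psum k n.+1 @^-1` B') * P (X n.+1 @^-1` D))%E.
  move=> mB' mD.
  (* The slot [Some n] is free in J by the strict bound on its indices; it receives an event of the
     summand X_(n+1). *)
  pose A' j := if j == Some n then X n.+1 @^-1` D else A j.
  have nJ : Some n \notin J by apply/negP => /Jn; rewrite ltnn.
  have A'J j : j \in J -> A' j = A j.
    by rewrite /A'; case: eqVneq => // ->; rewrite (negbTE nJ).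
  have := IH (Some n |` J)%fset A' B'.
  have A'n : A' (Some n) = X n.+1 @^-1` D by rewrite /A' eqxx.
  rewrite big_fsetU1//= A'n.
  rewrite (eq_big_seq (fun j => P (A j))); last by move=> j /A'J ->.
  rewrite (_ : \bigcap_(j in _) A' j = X n.+1 @^-1` D `&` Q); last first.
    apply/seteqP; split => t.
      move=> H; split; first by rewrite -A'n; apply: H; rewrite /= fset1U1.
      by move=> j /= jJ; rewrite -A'J//; apply: H; rewrite /= fset1Ur.
    move=> [Dt Qt] j /=; rewrite in_fset1U => /predU1P[->|jJ]; first by rewrite A'n.
    by rewrite A'J//; exact: Qt.
  rewrite -ind// -/Q => IH'.
  rewrite (setIC Q) IHJ// -setIA (setIC Q) IH'//.
  - by rewrite -muleA [(P (_ @^-1` D) * _)%E]muleC.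
  - move=> j; rewrite /A' in_fset1U; case: eqVneq => [-> _|_ /= /GA//].
    exists (D `*` setT); first exact: measurableX.
    by apply/seteqP; split => t //= [].
  - by move=> i; rewrite in_fset1U => /orP[/eqP[->]//|/Jn/ltnW].
transitivity (\int[P]_(t in Q) (\1_B (psum k n.+1 t + X n.+1 t))%:E)%E.
  rewrite -integral_indic//; last first.
    by rewrite -[X in measurable X]setTI; exact: measurable_psum.
  by apply: eq_integral => t _; rewrite -psumS.
have B0 (x : R * R) : (0 <= (\1_B (x.1 + x.2))%:E :> \bar R)%E by rewrite lee_fin.
have := @ge0_indep_integral _ _ _ P _ _ _ _ Q (psum k n.+1) (X n.+1) mQ
  (measurable_psum k n.+1) (mX _) QUV _ m1B B0.
rewrite /= -/F => ->.
rewrite -[X in (X * _)%E]ind// -/Q.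
apply: (ge0_event_indep_integral mQ (measurable_psum k n.+1) _ mF F0).
by move=> D mD; rewrite setIC IHJ// muleC.
Qed.

End random_sum.

(** * Bounded convergence *)

Section bounded_convergence.
Context {d : measure_display} {T : measurableType d} {R : realType}.
Variable P : probability T R.

Lemma bounded_cvg_Rintegral (f_ : nat -> T -> R) (f : T -> R) (c : R) :
  (forall n, measurable_fun setT (f_ n)) -> measurable_fun setT f ->
  (forall t, f_ ^~ t @ \oo --> f t) -> (forall n t, `|f_ n t| <= c) ->
  (fun n => \int[P]_t f_ n t) @ \oo --> \int[P]_t f t.
Proof.
move=> mf_ mf ff fc.
have [|||||fi _ H] := @dominated_convergence _ _ _ P setT measurableT
  (fun n t => (f_ n t)%:E) (fun t => (f t)%:E) (cst c%:E).
- by move=> n; exact/measurable_EFinP.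
- exact/measurable_EFinP.
- by apply: aeW => t _; apply: cvg_EFin; [exact: nearW|exact: ff].
- apply: (@bounded_integrable _ _ _ P setT (cst c) `|c|) => //.
- by apply: aeW => t n _; rewrite lee_fin.
apply: fine_cvg; rewrite fineK; last exact: (integrable_fin_num measurableT fi).
exact: H.
Qed.

End bounded_convergence.

(** * Derivatives along an affine map, and the equilibrium identity there *)

Section composition.
Context {R : realType}.
Variables (a s : R) (phi : R -> R).
Hypotheses (d1 : forall x, derivable phi x 1) (d2 : forall x, derivable (derive1 phi) x 1).

Let is_derive_affine (x : R) : is_derive x 1 (fun x : R => a * (s + x)) a.
Proof.
have H : is_derive x 1 (cst s + id) (0 + 1) by exact: is_deriveD.
have := is_deriveZ a H; rewrite /GRing.scale/= add0r mulr1.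
by [].
Qed.

Lemma is_derive_comp_affine (f : R -> R) (x : R) : (forall x, derivable f x 1) ->
  is_derive x 1 (fun x => f (a * (s + x))) (a * derive1 f (a * (s + x))).
Proof.
move=> df.
have H : is_derive (a * (s + x)) 1 f (derive1 f (a * (s + x))).
  by rewrite derive1E; exact: derivableP.
have := @is_derive1_comp R f (fun x => a * (s + x)) x _ _ H (is_derive_affine x).
by rewrite mulrC.
Qed.

Lemma derivable_comp_affine (x : R) : derivable (fun x => phi (a * (s + x))) x 1.
Proof. by have [] := is_derive_comp_affine x d1. Qed.

Lemma derive1_comp_affine :
  derive1 (fun x => phi (a * (s + x))) = fun x => a * derive1 phi (a * (s + x)).
Proof.
by apply/funext => x; rewrite derive1E; have [] := is_derive_comp_affine x d1.
Qed.

Let is_derive2 (x : R) : is_derive x 1 (derive1 (fun x => phi (a * (s + x))))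
  (a ^+ 2 * derive1 (derive1 phi) (a * (s + x))).
Proof.
rewrite derive1_comp_affine; have := is_deriveZ a (is_derive_comp_affine x d2).
by move=> /is_derive_eq; apply; rewrite /GRing.scale/= mulrA.
Qed.

Lemma derivable2_comp_affine (x : R) :
  derivable (derive1 (fun x => phi (a * (s + x)))) x 1.
Proof. by have [] := is_derive2 x. Qed.

Lemma derive2_comp_affine : derive1 (derive1 (fun x => phi (a * (s + x)))) =
  fun x => a ^+ 2 * derive1 (derive1 phi) (a * (s + x)).
Proof.
by apply/funext => x; rewrite derive1E; have [] := is_derive2 x.
Qed.

End composition.

(** The equilibrium identity is applied to x -> phi(a (s + x)), where s is a frozen value of
    S_(m-1): the term f(0) is phi(a s), and the second derivative produces the factor a^2. *)
Lemma equilibrium_affine d (T : measurableType d) (R : realType) (P : probability T R)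
    (X XL : T -> R) (v a s c : R) (phi : R -> R) :
  measurable_fun setT X -> measurable_fun setT XL -> equilibrium P X XL ->
  (\int[P]_t (X t ^+ 2)%:E = v%:E)%E ->
  (forall x, derivable phi x 1) -> (forall x, derivable (derive1 phi) x 1) ->
  measurable_fun setT phi -> measurable_fun setT (derive1 (derive1 phi)) ->
  (forall x, `|phi x| <= c) -> (forall x, `|derive1 (derive1 phi) x| <= c) ->
  \int[P]_t (phi (a * (s + X t)) - phi (a * s)) =
  2^-1 * v * a ^+ 2 * \int[P]_t derive1 (derive1 phi) (a * (s + XL t)).
Proof.
move=> mX mXL eqX Xv d1 d2 mphi mphi2 phic phi2c.
have := eqX (fun x => phi (a * (s + x))) (derivable_comp_affine d1)
  (derivable2_comp_affine d1 d2).
have ma (Y : T -> R) : measurable_fun setT Y -> measurable_fun setT (fun t => a * (s + Y t)).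
  by move=> mY; apply: measurable_funM => //; exact: measurable_funD.
have i1 : P.-integrable setT (EFin \o (fun t => phi (a * (s + X t)))).
  exact: (bounded_integrable P measurableT (measurableT_comp mphi (ma _ mX)) (fun t => phic _)).
have i2 : P.-integrable setT (EFin \o (fun t => derive1 (derive1 phi) (a * (s + XL t)))).
  exact: (bounded_integrable P measurableT (measurableT_comp mphi2 (ma _ mXL)) (fun t => phi2c _)).
have i3 : P.-integrable setT (EFin \o (fun t => a ^+ 2 * derive1 (derive1 phi) (a * (s + XL t)))).
  exact: (integrableZl measurableT (a ^+ 2) i2).
rewrite derive2_comp_affine// => /(_ i1 i3).
rewrite addr0 Xv.
have -> : (\int[P]_t (phi (a * (s + X t)))%:E)%E = (\int[P]_t (phi (a * (s + X t))))%:E.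
  by rewrite /Rintegral fineK//; exact: (integrable_fin_num measurableT i1).
have -> : (\int[P]_t (a ^+ 2 * derive1 (derive1 phi) (a * (s + XL t)))%:E)%E =
    (\int[P]_t (a ^+ 2 * derive1 (derive1 phi) (a * (s + XL t))))%:E.
  by rewrite /Rintegral fineK//; exact: (integrable_fin_num measurableT i3).
rewrite -!EFinM -EFinB => -[].
rewrite RintegralZl// RintegralB//; last first.
  exact: (bounded_integrable P measurableT (measurable_cst (phi (a * s))) (fun t => phic _)).
by rewrite probability_Rintegral_cst mulrA.
Qed.

(** * The equilibrium identity for the random sum *)

Section stein.
Context {d : measure_display} {T : measurableType d} {R : realType}.
Variables (P : probability T R) (N M : T -> nat) (X XL : nat -> T -> R).
Hypotheses (mN : forall n, measurable (N @^-1` [set n]))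
  (mM : forall n, measurable (M @^-1` [set n]))
  (mX : forall i, measurable_fun setT (X i))
  (mXL : forall i, measurable_fun setT (XL i)).
Hypothesis ind : mutually_independent P (fun o : option nat => match o with
     | None => sigma_pair_nat N M
     | Some i => sigma_pair_R (X i.+1) (XL i.+1)
     end).

Local Notation S := (psum X).
Local Notation NM := (fun t => (N t, M t)).

Lemma index_psum_indep (E : set (nat * nat)) k n B : (0 < k)%N -> measurable B ->
  P (NM @^-1` E `&` S k n @^-1` B) = (P (NM @^-1` E) * P (S k n @^-1` B))%E.
Proof.
move=> k0 mB.
have := psum_indep mN mM mX mXL ind (J := [fset None]%fset)
  (A := fun=> NM @^-1` E) (n := n) k0 _ _ mB.
rewrite big_seq_fset1 set_fset1 bigcap_set1 setIC muleC; apply.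
- by move=> j; rewrite in_fset1 => /eqP ->; exists E.
- by move=> i; rewrite in_fset1.
Qed.

(** The pair (X_n, X_n^L) is treated as one variable because its two components are coupled; the sum
    only involves indices below n. *)
Lemma index_psum_pair_indep (E : set (nat * nat)) k n B D :
  (0 < k)%N -> (0 < n)%N -> measurable B -> measurable D ->
  P (NM @^-1` E `&` S k n @^-1` B `&` (fun t => (X n t, XL n t)) @^-1` D) =
  (P (NM @^-1` E `&` S k n @^-1` B) * P ((fun t => (X n t, XL n t)) @^-1` D))%E.
Proof.
case: n => // n k0 _ mB mD; rewrite index_psum_indep//.
have := psum_indep mN mM mX mXL ind (J := [fset None; Some n]%fset)
  (A := fun o => if o is Some _ then (fun t => (X n.+1 t, XL n.+1 t)) @^-1` D
     else NM @^-1` E) (n := n.+1) k0 _ _ mB.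
rewrite big_fsetU1/= ?in_fset1// big_seq_fset1.
rewrite (_ : \bigcap_(j in _) _ = NM @^-1` E `&` (fun t => (X n.+1 t, XL n.+1 t)) @^-1` D).
  rewrite setICA setIA => ->.
  - by rewrite muleA [(P (S _ _ @^-1` B) * _)%E]muleC.
  - move=> j; rewrite !inE => /orP[/eqP ->|/eqP ->]; first by exists E.
    by exists D.
  - by move=> i; rewrite !inE => /eqP[->].
apply/seteqP; split => t.
  move=> H; split; first by apply: (H None); rewrite /= !inE.
  by apply: (H (Some n)); rewrite /= !inE eqxx.
by move=> [? ?] [j|] //=.
Qed.

Let mNM (E : set (nat * nat)) : measurable (NM @^-1` E).
Proof. exact: measurable_preimage_pair_nat. Qed.

Variables (sigma2 : nat -> R) (a : R).
Hypotheses (X2 : forall i, (1 <= i)%N -> (\int[P]_t (X i t ^+ 2)%:E = (sigma2 i)%:E)%E)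
  (eqX : forall i, (1 <= i)%N -> equilibrium P (X i) (XL i)).

Section test_function.
Variables (phi phi2 : R -> R) (c : R).
Hypotheses (d1 : forall x, derivable phi x 1)
  (d2 : forall x, derivable (derive1 phi) x 1)
  (phi2E : derive1 (derive1 phi) = phi2)
  (mphi2 : measurable_fun setT phi2)
  (phic : forall x, `|phi x| <= c)
  (phi2c : forall x, `|phi2 x| <= c).

Let mphi : measurable_fun setT phi.
Proof.
apply: continuous_measurable_fun => x.
exact/differentiable_continuous/derivable1_diffP.
Qed.

(** The conditional mean of phi''(a (S_(m-1) + X_m^L)) given S_(m-1) = u. Both sides of the identity
    are reduced to it. *)
Let F m (u : R) := \int[P]_s phi2 (a * (u + XL m s)).

Let mg2 : measurable_fun setT (fun x : R * (R * R) => phi2 (a * (x.1 + x.2.2))).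
Proof.
apply: (measurableT_comp mphi2); apply: measurable_funM => //.
by apply: measurable_funD => //; exact: measurableT_comp.
Qed.

Let mXX m : measurable_fun setT (fun t => (X m t, XL m t)).
Proof. exact: measurable_fun_pair. Qed.

Let FL (E : set (nat * nat)) m : (0 < m)%N -> measurable_fun setT (F m) /\
  \int[P]_(t in NM @^-1` E) phi2 (a * (S 1 m t + XL m t)) =
  \int[P]_(t in NM @^-1` E) F m (S 1 m t).
Proof.
move=> m0.
exact: (indep_Rintegral (mNM E) (measurable_psum mX 1 m) (mXX m)
  (fun B D => @index_psum_pair_indep E 1 m B D isT m0) mg2 (fun x => phi2c _)).
Qed.

Let Fc m u : `|F m u| <= c.
Proof.
apply: Rintegral_bound => //; apply: (measurableT_comp mphi2).
by apply: measurable_funM => //; exact: measurable_funD.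
Qed.

(** The event E survives only as the factor P(E), so two events of (N, M) give integrals in the
    ratio of their probabilities. *)
Let FA (E : set (nat * nat)) m : (0 < m)%N ->
  \int[P]_(t in NM @^-1` E) F m (S 1 m t) =
  fine (P (NM @^-1` E)) * \int[P]_t F m (S 1 m t).
Proof.
move=> m0.
exact: (@event_indep_Rintegral _ _ _ P _ _ _ (S 1 m) (mNM E)
  (measurable_psum mX 1 m) (fun D => @index_psum_indep E 1 m D isT) _ c (FL setT m0).1).
Qed.

Let FX (E : set (nat * nat)) m : (0 < m)%N ->
  \int[P]_(t in NM @^-1` E) (phi (a * S 1 m.+1 t) - phi (a * S 1 m t)) =
  2^-1 * sigma2 m * a ^+ 2 * \int[P]_(t in NM @^-1` E) F m (S 1 m t).
Proof.
move=> m0.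
have mg : measurable_fun setT (fun x : R * (R * R) => phi (a * (x.1 + x.2.1)) - phi (a * x.1)).
  apply: measurable_funB; apply: (measurableT_comp mphi); apply: measurable_funM => //.
  by apply: measurable_funD => //; exact: measurableT_comp.
have gc (x : R * (R * R)) : `|phi (a * (x.1 + x.2.1)) - phi (a * x.1)| <= c + c.
  by rewrite (le_trans (ler_normB _ _))// lerD.
have [_ /=] := indep_Rintegral (mNM E) (measurable_psum mX 1 m) (mXX m)
  (fun B D => @index_psum_pair_indep E 1 m B D isT m0) mg gc.
under eq_Rintegral do rewrite -psumS//.
move=> ->; rewrite -RintegralZl//; last first.
  apply: bounded_integrable (mNM E) (measurableT_comp (FL setT m0).1 (measurable_psum mX 1 m)) _.
  by move=> t; exact: Fc.
apply: eq_Rintegral => t _; rewrite /F -phi2E.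
by apply: (equilibrium_affine a (S 1 m t) (mX m) (mXL m) (eqX m0) (X2 m0) d1 d2 mphi _ phic);
  rewrite phi2E.
Qed.

Variable v : R.
Hypothesis M1 : forall t, (1 <= M t)%N.
Hypothesis lawM : forall m, (1 <= m)%N ->
  sigma2 m * fine (P [set t | (m <= N t)%N]) = v * fine (P (M @^-1` [set m])).

Definition stein_sum t := a * (S 1 (M t) t + XL (M t) t).

Lemma measurable_stein_sum : measurable_fun setT stein_sum.
Proof.
apply: measurable_funM => //; apply: measurable_funD.
  by apply: (measurable_fun_nat_index mM) => n; exact: measurable_psum.
exact: (measurable_fun_nat_index mM).
Qed.

Let phi2W t := phi2 (stein_sum t).

Let mphi2W : measurable_fun setT phi2W.
Proof. exact: (measurableT_comp mphi2 measurable_stein_sum). Qed.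

(** The increment over {N >= m} carries the weight sigma_m^2 P(N >= m), which [lawM] rewrites as v
    P(M = m). *)
Let step m : (0 < m)%N ->
  \int[P]_(t in [set t | (m <= N t)%N]) (phi (a * S 1 m.+1 t) - phi (a * S 1 m t)) =
  2^-1 * v * a ^+ 2 * \int[P]_(t in M @^-1` [set m]) phi2W t.
Proof.
move=> m0.
rewrite -[X in Rintegral _ X _ = _]/(NM @^-1` [set x | (m <= x.1)%N]) FX// FA//.
have -> : \int[P]_(t in M @^-1` [set m]) phi2W t =
    \int[P]_(t in NM @^-1` [set x | x.2 = m]) phi2 (a * (S 1 m t + XL m t)).
  by apply: eq_Rintegral => t /set_mem /= Mt; rewrite /phi2W /stein_sum Mt.
rewrite (FL _ m0).2 FA//.
have := lawM m0; rewrite -/(NM @^-1` [set x | (m <= x.1)%N]).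
rewrite -/(NM @^-1` [set x | x.2 = m]) => H.
set K := \int[P]_t _; rewrite mulrA.
rewrite [X in X * K = _](_ : _ = 2^-1 * a ^+ 2 * (sigma2 m * fine (P (NM @^-1` [set x | (m <= x.1)%N])))); last by ring.
by rewrite H; ring.
Qed.

(** With N cut to min(N, n) the telescoping is a finite induction: passing to n + 1 adds one
    increment on {N > n}, matched by the level M = n + 1 on the right. *)
Let trunc n : \int[P]_t phi (a * S 1 (minn (N t) n).+1 t) =
  phi 0 + 2^-1 * v * a ^+ 2 * \int[P]_(t in [set t | (M t <= n)%N]) phi2W t.
Proof.
elim: n => [|n IH].
  rewrite (_ : [set t | (M t <= 0)%N] = set0); last first.
    by apply/seteqP; split => t //=; rewrite leqNgt M1.
  rewrite Rintegral_set0 mulr0 addr0 -[RHS](probability_Rintegral_cst P).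
  by apply: eq_Rintegral => t _; rewrite minn0 psum_geq// mulr0.
have mNle : measurable [set t | (n < N t)%N].
  exact: (measurable_preimage_nat mN [set k | (n < k)%N]).
have mphiS k : measurable_fun setT (fun t => phi (a * S 1 k t)).
  by apply: (measurableT_comp mphi); apply: measurable_funM => //; exact: measurable_psum.
have mphiSmin k : measurable_fun setT (fun t => phi (a * S 1 (minn (N t) k).+1 t)).
  by apply: (measurable_fun_nat_index mN (F := fun j t => phi (a * S 1 (minn j k).+1 t))).
have dint (A : set T) : measurable A ->
    P.-integrable A (EFin \o (fun t => phi (a * S 1 n.+2 t) - phi (a * S 1 n.+1 t))).
  move=> mA; apply: (bounded_integrable P (c := c + c) mA); first exact: measurable_funB.
  by move=> t; rewrite (le_trans (ler_normB _ _))// lerD.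
have -> : \int[P]_t phi (a * S 1 (minn (N t) n.+1).+1 t) =
    \int[P]_t phi (a * S 1 (minn (N t) n).+1 t) +
    \int[P]_(t in [set t | (n < N t)%N]) (phi (a * S 1 n.+2 t) - phi (a * S 1 n.+1 t)).
  rewrite [X in _ + X]Rintegral_mkcond -RintegralD//; last 2 first.
  - exact: (bounded_integrable P (c := c)).
  - have /= := (integrable_mkcond (mu := P)
      (EFin \o (fun t => phi (a * S 1 n.+2 t) - phi (a * S 1 n.+1 t))) mNle).1.
    by rewrite restrict_EFin; apply; exact: dint.
  apply: eq_Rintegral => t _; rewrite patchE.
  case: ifPn => [/set_mem /= nN|/negP nN].
    by rewrite (minn_idPr nN) (minn_idPr (ltnW nN)) subrKC.
  have {}nN : (N t <= n)%N by rewrite leqNgt; apply/negP => ?; apply: nN; exact/mem_set.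
  by rewrite (minn_idPl nN) (minn_idPl (leqW nN)) addr0.
rewrite IH step// -addrA -mulrDr; congr (_ + _ * _).
rewrite -Rintegral_setU.
- congr (Rintegral _ _ _); apply/seteqP; split => t /=.
    by move=> [/leqW//|->].
  by rewrite leq_eqVlt ltnS => /orP[/eqP ?|?]; [right|left].
- exact: (measurable_preimage_nat mM [set k | (k <= n)%N]).
- exact: mM.
- apply: (bounded_integrable P (c := c)) => //; last by move=> t; exact: phi2c.
  by apply: measurableU; [exact: (measurable_preimage_nat mM [set k | (k <= n)%N])|exact: mM].
- by apply/disj_setPS => t /= [+ Mt]; rewrite Mt ltnn.
Qed.

(** As n grows, both truncated integrands are eventually constant at each point and bounded by c, so
    bounded convergence applies. The result is the equilibrium identity for W, with v a^2 in the
    role of E W^2. *)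
Lemma stein_identity : \int[P]_t phi (a * S 1 (N t).+1 t) =
  phi 0 + 2^-1 * v * a ^+ 2 * \int[P]_t phi2 (stein_sum t).
Proof.
have mphiS k : measurable_fun setT (fun t => phi (a * S 1 k t)).
  by apply: (measurableT_comp mphi); apply: measurable_funM => //; exact: measurable_psum.
have L : (fun n => \int[P]_t phi (a * S 1 (minn (N t) n).+1 t)) @ \oo -->
    \int[P]_t phi (a * S 1 (N t).+1 t).
  apply: (@bounded_cvg_Rintegral _ _ _ P _ _ c) => //.
  - move=> n.
    by apply: (measurable_fun_nat_index mN (F := fun j t => phi (a * S 1 (minn j n).+1 t))).
  - by apply: (measurable_fun_nat_index mN (F := fun j t => phi (a * S 1 j.+1 t))).
  - move=> t; apply: cvg_near_cst; near=> n.
    rewrite (minn_idPl _)//; near: n; exact: nbhs_infty_ge.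
have R' : (fun n => phi 0 + 2^-1 * v * a ^+ 2 *
    \int[P]_(t in [set t | (M t <= n)%N]) phi2W t) @ \oo -->
    phi 0 + 2^-1 * v * a ^+ 2 * \int[P]_t phi2W t.
  apply: cvgD; first exact: cvg_cst.
  apply: cvgM; first exact: cvg_cst.
  under eq_fun do rewrite Rintegral_mkcond.
  apply: (@bounded_cvg_Rintegral _ _ _ P _ _ c) => //.
  - move=> n; apply/(@measurable_restrictT _ _ _ _ [set t | (M t <= n)%N]).
      exact: (measurable_preimage_nat mM [set k | (k <= n)%N]).
    exact: measurable_funTS.
  - move=> t; apply: cvg_near_cst; near=> n.
    rewrite patchE mem_set//=; near: n; exact: nbhs_infty_ge.
  - move=> n t; rewrite patchE; case: ifP => _; first exact: phi2c.
    by rewrite normr0 (le_trans _ (phic 0)).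
move: L; rewrite (_ : (fun n => _) = fun n => phi 0 + 2^-1 * v * a ^+ 2 *
    \int[P]_(t in [set t | (M t <= n)%N]) phi2W t); last first.
  by apply/funext => n; exact: trunc.
move=> /cvg_lim <-//; exact/cvg_lim.
Unshelve. all: by end_near. Qed.

End test_function.
End stein.

(** * First moment and distribution function of the Laplace law *)

Section laplace_law.
Context {R : realType}.
Notation leb := (@lebesgue_measure R).
Variable b : R.
Hypothesis b0 : 0 < b.
Notation p := (laplace_pdf b).

(** Half of the exponential decay absorbs |x|: the integrand is at most 4b times the Laplace density
    of scale 2b. *)
Lemma integrable_norm_laplace : leb.-integrable setT (EFin \o (fun x => `|x| * p x)).
Proof.
have b20 : 0 < 2 * b by rewrite mulr_gt0.
have := @integrableZl _ _ _ leb setT measurableT (4 * b) _ (integrable_laplace_pdf b20).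
apply: le_integrable => //.
  by apply/measurable_EFinP; apply: measurable_funM => //; exact: measurable_laplace_pdf.
move=> x _ /=; rewrite lee_fin [leLHS]ger0_norm; last first.
  by rewrite mulr_ge0// laplace_pdf_ge0.
rewrite [leRHS]ger0_norm; last first.
  by apply: mulr_ge0; [rewrite mulr_ge0// ltW|exact: laplace_pdf_ge0].
rewrite /laplace_pdf.
set e := expR (- `|x| / (2 * b)).
have -> : expR (- `|x| / b) = e * e.
  by rewrite -expRD; congr expR; field; rewrite gt_eqF.
(* This is 1 + t <= e^t at t = |x|/(2b), multiplied by 2b. *)
have xe : `|x| * e <= 2 * b.
  rewrite /e mulNr expRN ler_pdivrMr ?expR_gt0//.
  have := expR_ge1Dx (`|x| / (2 * b)).
  move=> /(ler_wpM2l (ltW b20)); rewrite mulrDr mulrCA divff ?gt_eqF// !mulr1.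
  by apply: le_trans; rewrite lerDr ltW.
have -> : 4 * b * ((2 * (2 * b))^-1 * e) = e.
  by field; rewrite gt_eqF.
have -> : `|x| * ((2 * b)^-1 * (e * e)) = (2 * b)^-1 * (`|x| * e) * e by ring.
rewrite -[leRHS]mul1r ler_wpM2r ?expR_ge0//.
by rewrite mulrC ler_pdivrMr// mul1r.
Qed.

Definition laplace_cdf (x : R) : R := \int[leb]_(y in [set y | y <= x]) p y.

Let mle x : measurable [set y : R | y <= x].
Proof. by rewrite -set_itvNyc. Qed.

Let pint (D : set R) : measurable D -> leb.-integrable D (EFin \o p).
Proof.
by move=> mD; apply: integrableS (integrable_laplace_pdf b0).
Qed.

Lemma EFin_laplace_cdf x :
  (\int[leb]_(y in [set y : R | (y <= x)%R]) (p y)%:E = (laplace_cdf x)%:E)%E.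
Proof.
rewrite /laplace_cdf /Rintegral fineK//.
by apply: integrable_fin_num; [exact: mle|apply: pint; exact: mle].
Qed.

(** The density is at most 1/(2b); this is the smoothing cost of replacing a half-line by a ramp. *)
Lemma laplace_cdfD x e : 0 <= e -> laplace_cdf (x + e) <= laplace_cdf x + e / (2 * b).
Proof.
move=> e0.
have mI : measurable `]x, x + e]%classic by exact: measurable_itv.
have E : [set y | y <= x + e] = [set y | y <= x] `|` `]x, x + e]%classic.
  apply/seteqP; split => y /=.
    by move=> ye; have [yx|yx] := leP y x; [left|right; rewrite /= in_itv/= yx].
  by move=> [yx|]; [rewrite (le_trans yx)// lerDl|rewrite /= in_itv/= => /andP[]].
rewrite /laplace_cdf E Rintegral_setU; last 4 first.
- exact: mle.
- exact: mI.
- by apply: pint; apply: measurableU; [exact: mle|exact: mI].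
- by apply/disj_setPS => y /= [yx]; rewrite in_itv/= ltNge yx.
rewrite lerD2l.
apply: (@le_trans _ _ (\int[leb]_(y in `]x, (x + e)%R]) (2 * b)^-1)).
  apply: le_Rintegral => //; first exact: pint.
  - apply: measurable_bounded_integrable; first exact: mI.
    + by rewrite /= lebesgue_measure_itv/= lte_fin; case: ifP => _; rewrite ltry.
    + by [].
    by exists (2 * b)^-1; split; [exact: num_real|] => y cy t _ /=; rewrite ger0_norm; [exact: ltW|rewrite invr_ge0 mulr_ge0// ltW].
  - by move=> y _; exact: laplace_pdf_le.
rewrite Rintegral_cst//= lebesgue_measure_itv/= lte_fin ltrDl.
case: ltP => _ /=.
  by rewrite addrAC subrr add0r mulrC.
by rewrite mulr0 divr_ge0// mulr_ge0// ltW.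
Qed.

Lemma laplace_cdf_le_Rintegral (h : R -> R) x : measurable_fun setT h ->
  (forall y, 0 <= h y <= 1) -> (forall y, y <= x -> h y = 1) ->
  laplace_cdf x <= \int[leb]_y (h y * p y).
Proof.
move=> mh h01 hx; rewrite /laplace_cdf Rintegral_mkcond.
have h1 z : `|h z| <= 1 by rewrite ger0_norm//; case/andP: (h01 z).
apply: le_Rintegral => //.
- have /= := (@integrable_mkcond _ _ _ leb _ (EFin \o p) (mle x)).1 (pint (mle x)).
  by rewrite restrict_EFin.
- exact: (integrable_Mlaplace b0 mh h1).
- move=> y _; rewrite patchE; case: ifP => [/set_mem /= yx|_]; first by rewrite hx// mul1r.
  by rewrite mulr_ge0 ?laplace_pdf_ge0//; case/andP: (h01 y).
Qed.

Lemma Rintegral_le_laplace_cdf (h : R -> R) x : measurable_fun setT h ->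
  (forall y, 0 <= h y <= 1) -> (forall y, x < y -> h y = 0) ->
  \int[leb]_y (h y * p y) <= laplace_cdf x.
Proof.
move=> mh h01 hx; rewrite /laplace_cdf [leRHS]Rintegral_mkcond.
have h1 z : `|h z| <= 1 by rewrite ger0_norm//; case/andP: (h01 z).
apply: le_Rintegral => //.
- exact: (integrable_Mlaplace b0 mh h1).
- have /= := (@integrable_mkcond _ _ _ leb _ (EFin \o p) (mle x)).1 (pint (mle x)).
  by rewrite restrict_EFin.
- move=> y _; rewrite patchE; case: ifPn => [_|/negP yx].
    by rewrite ler_piMl ?laplace_pdf_ge0//; case/andP: (h01 y).
  rewrite hx ?mul0r// ltNge; apply/negP => yx'; apply: yx; exact/mem_set.
Qed.

End laplace_law.

(** * Continuous approximations of half-lines *)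

Section ramp.
Context {R : realType}.
Variables (x e : R).
Hypothesis e0 : 0 < e.

(** Equal to 1 up to x, to 0 from x + e on, and linear between, hence squeezed between the
    indicators of the half-lines ending at x and at x + e. *)
Definition ramp (y : R) : R := Num.min 1 (Num.max 0 (1 - (y - x) / e)).

Lemma continuous_ramp : continuous ramp.
Proof.
move=> y.
apply: (@continuous_min R R (cst 1) (fun y => Num.max 0 (1 - (y - x) / e))).
  exact: cst_continuous.
apply: (@continuous_max R R (cst 0) (fun y => 1 - (y - x) / e)).
  exact: cst_continuous.
apply: (@continuousB _ R^o _ (cst 1)); first exact: cst_continuous.
apply: (@continuousM _ R^o (fun y => y - x) (cst e^-1)); last exact: cst_continuous.
by apply: (@continuousB _ R^o _ id (cst x)); [|exact: cst_continuous].
Qed.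

Lemma ramp01 y : 0 <= ramp y <= 1.
Proof. by rewrite /ramp le_min ler01/= le_max lexx/= ge_min lexx. Qed.

Lemma ramp_nonincreasing : {homo ramp : y z / y <= z >-> z <= y}.
Proof.
move=> y z yz; rewrite /ramp le_min ge_min lexx/= ge_min; apply/orP; right.
have : 1 - (z - x) / e <= 1 - (y - x) / e.
  by rewrite lerD2l lerN2 ler_pM2r ?invr_gt0// lerD2r.
by move=> yz'; rewrite ge_max !le_max lexx/= yz' orbT.
Qed.

Lemma ramp1 y : y <= x -> ramp y = 1.
Proof.
move=> yx; rewrite /ramp; apply/min_idPl; rewrite le_max; apply/orP; right.
by rewrite lerBrDl gerDr pmulr_lle0 ?invr_gt0// subr_le0.
Qed.

Lemma ramp0 y : x + e <= y -> ramp y = 0.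
Proof.
move=> yx; rewrite /ramp; have -> : Num.max 0 (1 - (y - x) / e) = 0.
  by apply/max_idPl; rewrite subr_le0 ler_pdivlMr// mul1r lerBrDl.
by apply/min_idPr.
Qed.

End ramp.

(** * Distance bounds for W from its equilibrium partner *)

Section stein_pair.
Context {d : measure_display} {T : measurableType d} {R : realType}.
Notation leb := (@lebesgue_measure R).
Variables (P : probability T R) (b : R) (W WL : T -> R).
Hypotheses (b0 : 0 < b) (mW : measurable_fun setT W) (mWL : measurable_fun setT WL).
Notation p := (laplace_pdf b).
Notation u := (laplace_resolvent b).

(** The form in which both distance bounds use the equilibrium relation between W and W^L.
    Restricting it to bounded h keeps every integral finite. *)
Definition laplace_stein := forall (h : R -> R) (c : R), continuous h ->
  (forall x, `|h x| <= c) ->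
  \int[P]_t h (WL t) - \int[leb]_x (h x * p x) =
  \int[P]_t u h (WL t) - \int[P]_t u h (W t).

Hypothesis stW : laplace_stein.

Let measurable_le (x : R) : measurable [set y : R | y <= x].
Proof. by rewrite -set_itvNyc. Qed.

Let measurable_lt (x : R) : measurable [set y : R | y < x].
Proof. by rewrite -set_itvNyo. Qed.

Let mcont (h : R -> R) (Y : T -> R) : continuous h -> measurable_fun setT Y ->
  measurable_fun setT (fun t => h (Y t)).
Proof. by move=> ch mY; apply: measurableT_comp => //; exact: continuous_measurable_fun. Qed.

Let lip_continuous (h : R -> R) : lip1 h -> continuous h.
Proof.
move=> hl x; apply/cvgrPdist_lt => e e0; near=> y.
rewrite (le_lt_trans (hl _ _))//; near: y.
Unshelve. all: by end_near. Qed.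

Let max_lip (k x y : R) : `|Num.max k x - Num.max k y| <= `|x - y|.
Proof.
have := ler_norm (x - y); have := ler_norm (- (x - y)); rewrite normrN => ? ?.
by rewrite ler_norml /Num.max; case: ltP => ?; case: ltP => ?; lra.
Qed.

Let min_lip (k x y : R) : `|Num.min k x - Num.min k y| <= `|x - y|.
Proof.
have := ler_norm (x - y); have := ler_norm (- (x - y)); rewrite normrN => ? ?.
by rewrite ler_norml /Num.min; case: ltP => ?; case: ltP => ?; lra.
Qed.

Let lip_bound (h : R -> R) (c : R) (Y Z : T -> R) : lip1 h -> (forall x, `|h x| <= c) ->
  measurable_fun setT Y -> measurable_fun setT Z ->
  ((`|\int[P]_t h (Y t) - \int[P]_t h (Z t)|)%:E <= \int[P]_t (`|Z t - Y t|)%:E)%E.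
Proof.
move=> hl hc mY mZ.
have ch := lip_continuous hl.
have iY : P.-integrable setT (EFin \o (fun t => h (Y t))).
  exact: (bounded_integrable P measurableT (mcont ch mY) (fun t => hc _)).
have iZ : P.-integrable setT (EFin \o (fun t => h (Z t))).
  exact: (bounded_integrable P measurableT (mcont ch mZ) (fun t => hc _)).
rewrite -RintegralB//.
have iB : P.-integrable setT (EFin \o (fun t => h (Y t) - h (Z t))).
  exact: (integrableB measurableT iY iZ).
rewrite EFin_normr_Rintegral//.
rewrite (le_trans (le_abse_integral _ measurableT _))//.
  by have /integrableP[] := iB.
apply: ge0_le_integral => //.
- by apply/measurable_EFinP; apply: measurableT_comp => //; apply: measurable_funB; exact: mcont.
- by apply/measurable_EFinP; apply: measurableT_comp => //; exact: measurable_funB.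
- by move=> t _ /=; rewrite lee_fin distrC (le_trans (hl _ _)).
Qed.

(** The error is the difference of E u(W^L) - E u(W) and E h(W^L) - E h(W). Both u and h are
    1-Lipschitz, whence the factor 2. *)
Lemma bounded_lip1_laplace (h : R -> R) (c : R) : lip1 h -> (forall x, `|h x| <= c) ->
  ((`|\int[P]_t h (W t) - \int[leb]_x (h x * p x)|)%:E <=
   2%:E * \int[P]_t (`|W t - WL t|)%:E)%E.
Proof.
move=> hl hc.
have ch := lip_continuous hl.
have H1 := lip_bound hl hc mWL mW.
have H2 := lip_bound (laplace_resolvent_lip1 b0 ch hc hl) (le_laplace_resolvent b0 ch hc) mWL mW.
have -> : \int[P]_t h (W t) - \int[leb]_x (h x * p x) =
   (\int[P]_t u h (WL t) - \int[P]_t u h (W t)) -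
   (\int[P]_t h (WL t) - \int[P]_t h (W t)).
  by rewrite -(stW ch hc); ring.
rewrite (le_trans (y := (`|\int[P]_t u h (WL t) - \int[P]_t u h (W t)| +
   `|\int[P]_t h (WL t) - \int[P]_t h (W t)|)%:E))//.
  by rewrite lee_fin ler_normB.
rewrite EFinD (le_trans (leeD H2 H1))//.
by rewrite (_ : 2%:E = 1 + 1)%E// ge0_muleDl// !mul1e.
Qed.

(** Clamping h to [-n, n] keeps it 1-Lipschitz, and the bounded case gives an estimate free of n.
    Dominated convergence, with |h(0)| + |x| as majorant under both laws, removes the clamp. *)
Lemma lip1_laplace (h : R -> R) : P.-integrable setT (EFin \o W) -> lip1 h ->
  (`| \int[P]_t (h (W t))%:E - \int[leb]_x (h x * p x)%:E | <=
   2%:E * \int[P]_t (`|W t - WL t|)%:E)%E.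
Proof.
move=> iW hl.
have ch := lip_continuous hl.
have hb x : `|h x| <= `|h 0| + `|x|.
  rewrite -lerBlDl (le_trans (lerB_dist _ _))// (le_trans (hl _ _))//.
  by rewrite subr0.
pose hn (n : nat) x := Num.max (- n%:R) (Num.min n%:R (h x)).
have hn_lip n : lip1 (hn n).
  by move=> x y; rewrite (le_trans (max_lip _ _ _))// (le_trans (min_lip _ _ _)).
have nN n : - n%:R <= n%:R :> R by rewrite ge0_cp.
have hn_bound n x : `|hn n x| <= n%:R.
  by rewrite ler_norml /hn le_max lexx/= ge_max nN ge_min lexx.
have hn_h n x : `|hn n x| <= `|h x|.
  have hx : - `|h x| <= h x by rewrite lerNl -normrN ler_norm.
  have n0 : - n%:R <= `|h x| by rewrite (le_trans (y := 0)) ?oppr_le0.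
  have h0 : - `|h x| <= n%:R by rewrite (le_trans (y := 0)) ?oppr_le0.
  by rewrite ler_norml /hn le_max le_min hx h0 ge_max ge_min ler_norm n0 !orbT.
have hn_cvg x : hn ^~ x @ \oo --> h x.
  apply: cvg_near_cst; near=> n.
  have : `|h x| <= n%:R by near: n; exact: nbhs_infty_ger.
  by rewrite ler_norml => /andP[? ?]; rewrite /hn min_r// max_r.
have mh : measurable_fun setT h by exact: continuous_measurable_fun.
have mhn n : measurable_fun setT (hn n).
  by apply: continuous_measurable_fun; exact: lip_continuous.
have mp := @measurable_laplace_pdf _ b.
have [|||||iP _ LP] := @dominated_convergence _ _ _ P setT measurableT
  (fun n t => (hn n (W t))%:E) (fun t => (h (W t))%:E) (fun t => (`|h 0| + `|W t|)%:E).
- by move=> n; apply/measurable_EFinP; exact: measurableT_comp.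
- by apply/measurable_EFinP; exact: measurableT_comp.
- by apply: aeW => t _; apply: cvg_EFin; [exact: nearW|exact: hn_cvg].
- have i0 : P.-integrable setT (EFin \o cst `|h 0|) by exact: finite_measure_integrable_cst.
  exact: (integrableD measurableT i0 (integrable_norm iW)).
- by apply: aeW => t n _; rewrite lee_fin (le_trans (hn_h _ _)).
have [|||||iL _ LL] := @dominated_convergence _ _ _ leb setT measurableT
  (fun n x => (hn n x * p x)%:E) (fun x => (h x * p x)%:E)
  (fun x => (`|h 0| * p x + `|x| * p x)%:E).
- by move=> n; apply/measurable_EFinP; apply: measurable_funM; [exact: mhn|exact: mp].
- by apply/measurable_EFinP; apply: measurable_funM; [exact: mh|exact: mp].
- apply: aeW => x _; apply: cvg_EFin; first exact: nearW.
  by apply: cvgM; [exact: hn_cvg|exact: cvg_cst].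
- have i0 := @integrableZl _ _ _ leb setT measurableT `|h 0| _ (integrable_laplace_pdf b0).
  exact: (integrableD measurableT i0 (integrable_norm_laplace b0)).
- apply: aeW => x n _; rewrite lee_fin normrM (ger0_norm (laplace_pdf_ge0 b0 x)) -mulrDl.
  by rewrite ler_wpM2r ?laplace_pdf_ge0// (le_trans (hn_h _ _)).
have L : (fun n => (`| \int[P]_t (hn n (W t))%:E - \int[leb]_x (hn n x * p x)%:E |)%E) @ \oo -->
    (`| \int[P]_t (h (W t))%:E - \int[leb]_x (h x * p x)%:E |)%E.
  apply: cvg_abse; apply: cvgeB => //.
  by rewrite fin_num_adde_defr//; exact: (integrable_fin_num measurableT iP).
apply: (cvge_le _ L); apply: nearW => n.
rewrite (le_trans _ (bounded_lip1_laplace (hn_lip n) (hn_bound n)))//.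
have fP : (\int[P]_t (hn n (W t))%:E)%E \is a fin_num.
  apply: (@integrable_fin_num _ _ _ P setT measurableT).
  exact: (bounded_integrable P measurableT (measurableT_comp (mhn n) mW) (fun t => hn_bound n _)).
have fL : (\int[leb]_x (hn n x * p x)%:E)%E \is a fin_num.
  apply: (@integrable_fin_num _ _ _ leb setT measurableT).
  exact: (integrable_Mlaplace b0 (mhn n) (hn_bound n)).
by rewrite -[X in (`|X - _|)%E](fineK fP) -[X in (`|_ - X|)%E](fineK fL).
Unshelve. all: by end_near. Qed.

(* A lower set lies between the two half-lines at its supremum, which is why the
   comparison of the tails is assumed with a strict inequality on the right. *)
Lemma dominated_nonincreasing (Y Z : T -> R) (f : R -> R) (c : R) :
  measurable_fun setT Y -> measurable_fun setT Z -> continuous f ->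
  (forall x, 0 <= f x <= c) -> {homo f : x y / x <= y >-> y <= x} ->
  (forall x, P [set t | Y t <= x]%R <= P [set t | Z t < x]%R)%E ->
  \int[P]_t f (Y t) <= \int[P]_t f (Z t).
Proof.
move=> mY mZ cf f0c fni YZ.
have f0 x : 0 <= f x by case/andP: (f0c x).
have fc x : `|f x| <= c by rewrite ger0_norm//; case/andP: (f0c x).
have mfY := mcont cf mY; have mfZ := mcont cf mZ.
pose fY : {RV P >-> R} := HB.pack (fun t => f (Y t)) (isMeasurableFun.Build _ _ _ _ _ mfY).
pose fZ : {RV P >-> R} := HB.pack (fun t => f (Z t)) (isMeasurableFun.Build _ _ _ _ _ mfZ).
have iY : P.-integrable setT (EFin \o (fun t => f (Y t))).
  exact: (bounded_integrable P measurableT mfY (fun t => fc _)).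
have iZ : P.-integrable setT (EFin \o (fun t => f (Z t))).
  exact: (bounded_integrable P measurableT mfZ (fun t => fc _)).
apply: fine_le; [exact: integrable_fin_num|exact: integrable_fin_num|].
(* The layer-cake formula reduces the claim to super-level sets of f. As f is nonincreasing these
   are lower sets: empty, bounded above, or the whole line. *)
rewrite -[X in (X <= _)%E](@expectation_def _ _ _ P fY).
rewrite -[X in (_ <= X)%E](@expectation_def _ _ _ P fZ).
rewrite (@ge0_expectation_ccdf _ _ _ P fY (fun t => f0 _)).
rewrite (@ge0_expectation_ccdf _ _ _ P fZ (fun t => f0 _)).
apply: ge0_le_integral => //.
- by apply: measurable_funTS; exact: ccdf_measurable.
- by apply: measurable_funTS; exact: ccdf_measurable.
move=> r _; rewrite /ccdf /distribution /pushforward /=.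
pose L := [set x | r < f x].
have Ldown x y : x <= y -> L y -> L x by rewrite /L /= => /fni xy /lt_le_trans; apply.
have mL : measurable L.
  have mf : measurable_fun setT f by exact: continuous_measurable_fun.
  rewrite (_ : L = setT `&` f @^-1` `]r, +oo[%classic); first exact: mf.
  by rewrite setTI; apply/seteqP; split => x /=; rewrite in_itv/= andbT.
have mpre (V : T -> R) (B : set R) : measurable_fun setT V -> measurable B -> measurable (V @^-1` B).
  by move=> mV mB; rewrite -[X in measurable X]setTI; exact: mV.
have LE (V : T -> R) : (fun t => f (V t)) @^-1` `]r, +oo[%classic = V @^-1` L.
  by apply/seteqP; split => t /=; rewrite in_itv/= andbT.
rewrite !LE.
have [->|/set0P[x0 Lx0]] := eqVneq L set0; first by rewrite !preimage_set0.
have [[z Lz]|noub] := pselect (has_ubound L).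
  have supL : has_sup L by split; [exists x0|exists z].
  apply: (@le_trans _ _ (P [set t | Y t <= sup L])).
    apply: le_measure.
    - by apply/mem_set; exact: (mpre _ _ mY mL).
    - by apply/mem_set; exact: (mpre _ _ mY (measurable_le _)).
    by move=> t; exact: sup_upper_bound.
  apply: (le_trans (YZ _)).
  apply: le_measure.
  - by apply/mem_set; exact: (mpre _ _ mZ (measurable_lt _)).
  - by apply/mem_set; exact: (mpre _ _ mZ mL).
  move=> t /= Zt; have [|y Ly] := @sup_adherent _ L (sup L - Z t) _ supL.
    by rewrite subr_gt0.
  by rewrite subKr => /ltW/Ldown; apply.
have -> : L = setT.
  apply/seteqP; split => // x _; apply: contrapT => nLx; apply: noub; exists x.
  by move=> y Ly; rewrite leNgt; apply/negP => /ltW/Ldown/(_ Ly).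
by rewrite !preimage_setT.
Qed.

Let ramp_norm y e x : `|ramp y e x| <= 1 :> R.
Proof. by have /andP[? ?] := ramp01 y e x; rewrite ger0_norm. Qed.

(** The hypothesis puts Z - e stochastically below Y, so the nonincreasing u has the larger mean at
    Z - e; undoing the shift costs e/b by the Lipschitz bound. *)
Let resolvent_dominated (e y : R) (Y Z : T -> R) : 0 < e ->
  measurable_fun setT Y -> measurable_fun setT Z ->
  (forall x, P [set t | Y t <= x]%R <= P [set t | Z t < x + e]%R)%E ->
  \int[P]_t u (ramp y e) (Y t) <= \int[P]_t u (ramp y e) (Z t) + e / b.
Proof.
move=> e0 mY mZ YZ.
have cr := @continuous_ramp _ y e.
have rn := ramp_norm y e.
have cu := continuous_laplace_resolvent b0 cr rn.
have un := le_laplace_resolvent b0 cr rn.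
have u0 x : 0 <= u (ramp y e) x.
  by apply: (laplace_resolvent_ge0 b0) => z; have /andP[] := ramp01 y e z.
have mZe : measurable_fun setT (fun t => Z t - e) by exact: measurable_funB.
apply: (@le_trans _ _ (\int[P]_t u (ramp y e) (Z t - e))).
  apply: (@dominated_nonincreasing Y (fun t => Z t - e) _ 1) => //.
  - by move=> x; rewrite u0/= (le_trans (ler_norm _)).
  - apply: (laplace_resolvent_nonincreasing b0 cr rn).
    exact: ramp_nonincreasing.
  - by move=> x; under [X in (_ <= P X)%E]eq_set do rewrite ltrBlDr.
have iZ : P.-integrable setT (EFin \o (fun t => u (ramp y e) (Z t))).
  exact: (bounded_integrable P measurableT (mcont cu mZ) (fun t => un _)).
have iZe : P.-integrable setT (EFin \o (fun t => u (ramp y e) (Z t - e))).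
  exact: (bounded_integrable P measurableT (mcont cu mZe) (fun t => un _)).
have ie : P.-integrable setT (EFin \o cst (e / b)) by exact: finite_measure_integrable_cst.
rewrite -[X in _ + X](probability_Rintegral_cst P) -RintegralD//.
apply: le_Rintegral => //; first exact: (integrableD measurableT iZ ie).
move=> t _; rewrite -lerBlDl (le_trans (ler_norm _))//.
rewrite (le_trans (laplace_resolvent_lipschitz b0 cr (ramp01 y e) _ _))//.
by rewrite addrAC subrr sub0r normrN gtr0_norm// mulrC.
Qed.

(** Two errors of size e/b: one from comparing the means of u at W and W^L, the other from moving
    the Laplace distribution function by 2e, namely e for the comparison of tails and e for the
    width of the ramp. *)
Lemma kolmogorov_stein (e x : R) : 0 < e ->
  (forall x, P [set t | W t <= x]%R <= P [set t | WL t < x + e]%R)%E ->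
  (forall x, P [set t | WL t <= x]%R <= P [set t | W t < x + e]%R)%E ->
  (`| P [set t | (W t <= x)%R] -
    \int[leb]_(y in [set y : R | (y <= x)%R]) (p y)%:E | <= (2 * e / b)%:E)%E.
Proof.
move=> e0 WWL WLW.
rewrite EFin_laplace_cdf//.
have mpre (V : T -> R) (B : set R) : measurable_fun setT V -> measurable B -> measurable (V @^-1` B).
  by move=> mV mB; rewrite -[X in measurable X]setTI; exact: mV.
have mle z : measurable [set t | W t <= z] := mpre _ _ mW (measurable_le z).
have mlL z : measurable [set t | WL t <= z] := mpre _ _ mWL (measurable_le z).
have mltL z : measurable [set t | WL t < z] := mpre _ _ mWL (measurable_lt z).
have mlt z : measurable [set t | W t < z] := mpre _ _ mW (measurable_lt z).
have fP : P [set t | W t <= x] \is a fin_num by exact: fin_num_measure.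
have iR y : P.-integrable setT (EFin \o (fun t => ramp y e (WL t))).
  exact: (bounded_integrable P measurableT (mcont (@continuous_ramp _ y e) mWL) (fun t => ramp_norm _ _ _)).
have mr y : measurable_fun setT (ramp y e).
  by apply: continuous_measurable_fun; exact: continuous_ramp.
(* The ramp starts at x + e, so it is 1 wherever W^L < x + e, and it vanishes from x + 2e on. *)
have up : fine (P [set t | W t <= x]) <= laplace_cdf b x + 2 * e / b.
  have H1 : fine (P [set t | W t <= x]) <= \int[P]_t ramp (x + e) e (WL t).
    rewrite -lee_fin (fineK fP)// (le_trans (WWL x))//.
    rewrite -[X in (P X <= _)%E]setIT -integral_indic// /Rintegral fineK; last first.
      exact: (integrable_fin_num measurableT (iR _)).
    apply: ge0_le_integral => //.
    - by apply/measurable_EFinP; exact: measurable_indic.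
    - by apply/measurable_EFinP; exact: measurableT_comp.
    - move=> t _; rewrite lee_fin indicE; case: (boolP (t \in _)) => [/set_mem/= /ltW/ramp1->//|_].
      by have /andP[] := ramp01 (x + e) e (WL t).
  have H2 := stW (@continuous_ramp _ (x + e) e) (ramp_norm (x + e) e).
  have H3 := resolvent_dominated (x + e) e0 mWL mW WLW.
  have H4 : \int[leb]_y (ramp (x + e) e y * p y) <= laplace_cdf b (x + e + e).
    apply: Rintegral_le_laplace_cdf => //; first exact: ramp01.
    by move=> y /ltW; exact: ramp0.
  have H5 : laplace_cdf b (x + e + e) <= laplace_cdf b x + e / b.
    rewrite -addrA (le_trans (laplace_cdfD b0 _ _))//; first by rewrite addr_ge0 ?ltW.
    by rewrite lerD2l -mulr2n -[e *+ 2]mulr_natl -mulf_div divff ?mul1r// pnatr_eq0.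
  have -> : 2 * e / b = e / b + e / b by ring.
  rewrite (le_trans H1)// -(subrK (\int[leb]_y (ramp (x + e) e y * p y)) (\int[P]_t _)).
  rewrite H2 [leLHS]addrC [leRHS]addrA; apply: lerD; first exact: le_trans H4 H5.
  by rewrite lerBlDl.
(* The ramp starts at x - 2e, so it vanishes from x - e on and is 1 up to x - 2e. *)
have lo : laplace_cdf b x - 2 * e / b <= fine (P [set t | W t <= x]).
  have H1 : \int[P]_t ramp (x - e - e) e (WL t) <= fine (P [set t | W t <= x]).
    rewrite -lee_fin (fineK fP)//.
    apply: (@le_trans _ _ (P [set t | W t < x - e + e])); last first.
      apply: le_measure; [apply/mem_set; exact: mlt|apply/mem_set; exact: mle|] => t /=.
      by rewrite subrK => /ltW.
    apply: le_trans (WLW _).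
    rewrite -[X in (_ <= P X)%E]setIT -integral_indic// /Rintegral fineK; last first.
      exact: (integrable_fin_num measurableT (iR _)).
    apply: ge0_le_integral => //.
    - by move=> t _; rewrite lee_fin; have /andP[] := ramp01 (x - e - e) e (WL t).
    - by apply/measurable_EFinP; exact: measurableT_comp.
    - by apply/measurable_EFinP; exact: measurable_indic.
    - move=> t _; rewrite lee_fin indicE; case: (boolP (t \in _)) => [_|/negP xt].
        by have /andP[] := ramp01 (x - e - e) e (WL t).
      rewrite ramp0// subrK leNgt; apply/negP => /ltW tx; apply: xt; exact/mem_set.
  have H2 := stW (@continuous_ramp _ (x - e - e) e) (ramp_norm (x - e - e) e).
  have H3 := resolvent_dominated (x - e - e) e0 mW mWL WWL.
  have H4 : laplace_cdf b (x - e - e) <= \int[leb]_y (ramp (x - e - e) e y * p y).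
    apply: laplace_cdf_le_Rintegral => //; first exact: ramp01.
    by move=> y; exact: ramp1.
  have H5 : laplace_cdf b x <= laplace_cdf b (x - e - e) + e / b.
    rewrite [in leLHS](_ : x = x - e - e + (e + e)); last by ring.
    rewrite (le_trans (laplace_cdfD b0 _ _))//; first by rewrite addr_ge0 ?ltW.
    by rewrite lerD2l -mulr2n -[e *+ 2]mulr_natl -mulf_div divff ?mul1r// pnatr_eq0.
  have -> : 2 * e / b = e / b + e / b by ring.
  apply: le_trans H1; rewrite -(subrK (\int[leb]_y (ramp (x - e - e) e y * p y)) (\int[P]_t _)).
  rewrite H2 [leRHS]addrC opprD [leLHS]addrA; apply: lerD.
    by rewrite lerBlDr (le_trans H5)// lerD2r.
  by rewrite lerNl opprB lerBlDl.
rewrite -(fineK fP) -EFinB abse_EFin lee_fin ler_norml.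
by rewrite lerBlDl up andbT lerNl opprB lerBlDl -lerBlDr.
Qed.

End stein_pair.

(** * The random sum satisfies the Laplace relation *)

Section stein_laplace.
Context {d : measure_display} {T : measurableType d} {R : realType}.
Variables (P : probability T R) (N M : T -> nat) (X XL : nat -> T -> R).
Hypotheses (mN : forall n, measurable (N @^-1` [set n]))
  (mM : forall n, measurable (M @^-1` [set n]))
  (mX : forall i, measurable_fun setT (X i))
  (mXL : forall i, measurable_fun setT (XL i)).
Hypothesis ind : mutually_independent P (fun o : option nat => match o with
     | None => sigma_pair_nat N M
     | Some i => sigma_pair_R (X i.+1) (XL i.+1)
     end).

Local Notation S := (psum X).
Local Notation NM := (fun t => (N t, M t)).

Variables (sigma2 : nat -> R) (a v b : R).
Hypotheses (X2 : forall i, (1 <= i)%N -> (\int[P]_t (X i t ^+ 2)%:E = (sigma2 i)%:E)%E)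
  (eqX : forall i, (1 <= i)%N -> equilibrium P (X i) (XL i))
  (M1 : forall t, (1 <= M t)%N)
  (lawM : forall m, (1 <= m)%N ->
    sigma2 m * fine (P [set t | (m <= N t)%N]) = v * fine (P (M @^-1` [set m])))
  (b0 : 0 < b) (bE : b ^+ 2 = 2^-1 * v * a ^+ 2).

(** For phi = u one has phi'' = b^(-2) (u - h), and [bE] makes the prefactor of the identity equal
    to b^2. Hence E u(W) = u(0) + E (u - h)(W^L), where u(0) is the Laplace mean of h. *)
Lemma laplace_stein_sum :
  laplace_stein P b (fun t => a * S 1 (N t).+1 t) (stein_sum M X XL a).
Proof.
move=> h c ch hc.
pose u := laplace_resolvent b h.
have cu : continuous u by exact: (continuous_laplace_resolvent b0 ch hc).
have uc := le_laplace_resolvent b0 ch hc.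
have c0 : 0 <= c by rewrite (le_trans _ (hc 0)).
have mu : measurable_fun setT u by exact: continuous_measurable_fun.
have mh : measurable_fun setT h by exact: continuous_measurable_fun.
have mWL : measurable_fun setT (stein_sum M X XL a) by exact: measurable_stein_sum.
pose phi2 x := b ^- 2 * (u x - h x).
have phi2E : derive1 (derive1 u) = phi2.
  apply/funext => x; rewrite derive1E.
  by have [] := is_derive2_laplace_resolvent b0 ch hc x.
have mphi2 : measurable_fun setT phi2.
  by apply: measurable_funM => //; exact: measurable_funB.
have b20 : 0 <= b ^- 2 by rewrite invr_ge0 exprn_ge0// ltW.
pose C := c + b ^- 2 * (c + c).
have phic x : `|u x| <= C.
  by rewrite (le_trans (uc x))// lerDl mulr_ge0// addr_ge0.
have phi2c x : `|phi2 x| <= C.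
  rewrite normrM ger0_norm// (le_trans (y := b ^- 2 * (c + c)))//.
    by rewrite ler_wpM2l// (le_trans (ler_normB _ _))// lerD.
  by rewrite lerDr.
have := stein_identity mN mM mX mXL ind a X2 eqX
  (derivable_laplace_resolvent b0 ch hc) (derivable2_laplace_resolvent b0 ch hc)
  phi2E mphi2 phic phi2c M1 lawM.
rewrite -bE -/u => ->.
have iu : P.-integrable setT (EFin \o (fun t => u (stein_sum M X XL a t))).
  exact: (bounded_integrable P measurableT (measurableT_comp mu mWL) (fun t => uc _)).
have ih : P.-integrable setT (EFin \o (fun t => h (stein_sum M X XL a t))).
  exact: (bounded_integrable P measurableT (measurableT_comp mh mWL) (fun t => hc _)).
have iuh : P.-integrable setT (EFin \o
    (fun t => u (stein_sum M X XL a t) - h (stein_sum M X XL a t))).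
  exact: (integrableB measurableT iu ih).
rewrite RintegralZl// RintegralB// mulrA divff ?mul1r ?expf_neq0 ?gt_eqF//.
rewrite /u laplace_resolvent0.
have aux (x y z : R) : x - y = z - (y + (z - x)) by ring.
exact: aux.
Qed.

End stein_laplace.

Lemma minn_lt_maxn (n m : nat) : n != m -> (minn n m < maxn n m)%N.
Proof. by move=> /eqP nm; lia. Qed.

(** * Second and first moments of partial and random sums *)

Section moments.
Context {d : measure_display} {T : measurableType d} {R : realType}.
Variables (P : probability T R) (N M : T -> nat) (X XL : nat -> T -> R).
Hypotheses (mN : forall n, measurable (N @^-1` [set n]))
  (mM : forall n, measurable (M @^-1` [set n]))
  (mX : forall i, measurable_fun setT (X i))
  (mXL : forall i, measurable_fun setT (XL i)).
Hypothesis ind : mutually_independent P (fun o : option nat => match o with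
     | None => sigma_pair_nat N M
     | Some i => sigma_pair_R (X i.+1) (XL i.+1)
     end).

Local Notation S := (psum X).
Local Notation NM := (fun t => (N t, M t)).

Variables (sigma2 : nat -> R).
Hypotheses
  (X1 : forall i, (1 <= i)%N ->
     P.-integrable setT (EFin \o X i) /\ (\int[P]_t (X i t)%:E = 0)%E)
  (X2 : forall i, (1 <= i)%N ->
     0 < sigma2 i /\ (\int[P]_t (X i t ^+ 2)%:E = (sigma2 i)%:E)%E).

Let mNM (E : set (nat * nat)) : measurable (NM @^-1` E).
Proof. exact: measurable_preimage_pair_nat. Qed.

Lemma probability_integral_cst (c : R) : (\int[P]_t c%:E = c%:E)%E.
Proof.
by rewrite integral_cst// -[RHS]mule1; congr (_ * _)%E; exact: probability_setT.
Qed.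

Lemma integral_sqrD u i : (0 < i)%N ->
  (\int[P]_s ((u + X i s) ^+ 2)%:E = (u ^+ 2 + sigma2 i)%:E)%E.
Proof.
move=> i0; have [iX EX] := X1 i0; have [s0 EX2] := X2 i0.
have iX2 : P.-integrable setT (EFin \o (fun s => X i s ^+ 2)).
  apply/integrableP; split; first by apply/measurable_EFinP; exact: measurable_funX.
  under eq_integral do rewrite /= ger0_norm ?sqr_ge0//.
  by rewrite EX2 ltry.
have i0' : P.-integrable setT (EFin \o cst (u ^+ 2)) by exact: finite_measure_integrable_cst.
have i1 : P.-integrable setT (EFin \o (fun s => 2 * u * X i s)).
  exact: (integrableZl measurableT (2 * u) iX).
have i01 : P.-integrable setT (EFin \o (fun s => u ^+ 2 + 2 * u * X i s)).
  exact: (integrableD measurableT i0' i1).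
have iA : P.-integrable setT (EFin \o (fun s => u ^+ 2 + 2 * u * X i s + X i s ^+ 2)).
  exact: (integrableD measurableT i01 iX2).
under eq_integral => s _.
  rewrite (_ : (u + X i s) ^+ 2 = u ^+ 2 + 2 * u * X i s + X i s ^+ 2); last by ring.
  over.
rewrite -[LHS]fineK; last exact: (integrable_fin_num measurableT iA).
congr EFin.
rewrite -/(Rintegral P setT (fun s => u ^+ 2 + 2 * u * X i s + X i s ^+ 2)).
rewrite !RintegralD// RintegralZl// probability_Rintegral_cst.
by rewrite /Rintegral EX EX2 /= mulr0 addr0.
Qed.

(** Conditionally on the earlier terms, the cross term with the centered last summand vanishes, so
    the variances add. *)
Lemma integral_psum_sqr k n : (0 < k)%N ->
  (\int[P]_t (S k n t ^+ 2)%:E = (\sum_(k <= i < n) sigma2 i)%:E)%E.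
Proof.
move=> k0.
have zero m : (m <= k)%N -> (\int[P]_t (S k m t ^+ 2)%:E = (\sum_(k <= i < m) sigma2 i)%:E)%E.
  move=> mk; rewrite psum_geq// big_geq//; under eq_integral do rewrite /= expr0n.
  by rewrite integral0.
elim: n => [|n IH]; first exact: zero.
have [nk|kn] := ltnP n k; first exact: zero.
have n0 : (0 < n)%N by exact: leq_trans kn.
have mXX : measurable_fun setT (fun t => (X n t, XL n t)) by exact: measurable_fun_pair.
have mg : measurable_fun setT (fun x : R * (R * R) => ((x.1 + x.2.1) ^+ 2)%:E : \bar R).
  apply/measurable_EFinP; apply: measurable_funX; apply: measurable_funD => //.
  exact: measurableT_comp.
have g0 (x : R * (R * R)) : (0 <= ((x.1 + x.2.1) ^+ 2)%:E :> \bar R)%E by rewrite lee_fin sqr_ge0.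
have := ge0_indep_integral (mNM setT) (measurable_psum mX k n) mXX
  (fun B D => @index_psum_pair_indep _ _ _ P N M X XL mN mM mX mXL ind setT k n B D k0 n0) mg g0.
rewrite preimage_setT /=.
under eq_integral do rewrite -psumS//.
move=> ->.
under eq_integral do rewrite integral_sqrD// EFinD.
rewrite ge0_integralD//.
- by rewrite IH probability_integral_cst -EFinD big_nat_recr.
- by move=> t _; rewrite lee_fin sqr_ge0.
- by apply/measurable_EFinP; apply: measurable_funX; exact: measurable_psum.
- by move=> t _; rewrite lee_fin ltW//; have [] := X2 n0.
Qed.

(** From (|s| - r)^2 >= 0 one gets |s| <= s^2/(2r) + r/2, which stands in for Cauchy-Schwarz and
    accepts any r above the standard deviation. *)
Lemma integral_psum_norm_le k n r : (0 < k)%N -> 0 < r ->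
  \sum_(k <= i < n) sigma2 i <= r ^+ 2 ->
  (\int[P]_t (`|S k n t|)%:E <= r%:E)%E.
Proof.
move=> k0 r0 sr.
have r20 : 0 <= (2 * r)^-1 by rewrite invr_ge0 mulr_ge0// ltW.
apply: (@le_trans _ _ (\int[P]_t (((2 * r)^-1)%:E * (S k n t ^+ 2)%:E + (r / 2)%:E))%E).
  apply: ge0_le_integral => //.
  - apply/measurable_EFinP; apply: measurableT_comp => //; exact: measurable_psum.
  - apply: emeasurable_funD => //; apply: emeasurable_funM => //.
    by apply/measurable_EFinP; apply: measurable_funX; exact: measurable_psum.
  - move=> t _; rewrite -EFinM -EFinD lee_fin.
    have : 0 <= (2 * r)^-1 * (`|S k n t| - r) ^+ 2 by rewrite mulr_ge0// sqr_ge0.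
    rewrite -[S k n t ^+ 2]real_normK ?num_real//.
    have -> : (2 * r)^-1 * (`|S k n t| - r) ^+ 2 =
        (2 * r)^-1 * `|S k n t| ^+ 2 + r / 2 - `|S k n t|.
      by field; rewrite gt_eqF.
    by rewrite subr_ge0.
rewrite ge0_integralD//; last 3 first.
- by move=> t _; rewrite mule_ge0// lee_fin// sqr_ge0.
- apply: emeasurable_funM => //.
  by apply/measurable_EFinP; apply: measurable_funX; exact: measurable_psum.
- by move=> t _; rewrite lee_fin divr_ge0// ltW.
rewrite ge0_integralZl//; last 2 first.
- by apply/measurable_EFinP; apply: measurable_funX; exact: measurable_psum.
- by move=> t _; rewrite lee_fin sqr_ge0.
rewrite integral_psum_sqr// probability_integral_cst.
rewrite -EFinM -EFinD lee_fin.
have e : r = (2 * r)^-1 * r ^+ 2 + r / 2 by field; rewrite gt_eqF.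
by rewrite [leRHS]e lerD2r ler_wpM2l.
Qed.

Lemma index_psum_integral (E : set (nat * nat)) k n : (0 < k)%N ->
  (\int[P]_(t in NM @^-1` E) (`|S k n t|)%:E =
   P (NM @^-1` E) * \int[P]_t (`|S k n t|)%:E)%E.
Proof.
move=> k0.
apply: (@ge0_event_indep_integral _ _ _ P _ _ _ (S k n) (mNM E) (measurable_psum mX k n)
  (fun D => @index_psum_indep _ _ _ P N M X XL mN mM mX mXL ind E k n D k0)
  (fun x => (`|x|)%:E)) => //.
by apply/measurable_EFinP; exact: normr_measurable.
Qed.

Lemma psum_cat k m n t : (k <= m)%N -> (m <= n)%N -> S k n t = S k m t + S m n t.
Proof. by move=> km mn; rewrite /psum -big_cat_nat. Qed.

Lemma psum_dist n m t :
  `|S 1 n.+1 t - S 1 m.+1 t| = `|S (minn n m).+1 (maxn n m).+1 t|.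
Proof.
wlog nm : n m / (n <= m)%N => [H|].
  case/orP: (leq_total n m) => [|mn]; first exact: H.
  by rewrite distrC H// minnC maxnC.
rewrite (minn_idPl nm) (maxn_idPr nm) distrC (@psum_cat 1 n.+1 m.+1)//.
by rewrite addrAC subrr add0r.
Qed.

Lemma nat_dist (n m : nat) : `|n%:R - m%:R| = ((maxn n m) - (minn n m))%:R :> R.
Proof.
wlog nm : n m / (n <= m)%N => [H|].
  case/orP: (leq_total n m) => [|mn]; first exact: H.
  by rewrite distrC H// minnC maxnC.
rewrite (minn_idPl nm) (maxn_idPr nm) distrC natrB// ger0_norm//.
by rewrite subr_ge0 ler_nat.
Qed.

Lemma sum_sigma2_le k n (s : R) : (0 < k)%N -> (k <= n)%N ->
  (forall i, (1 <= i)%N -> sigma2 i <= s ^+ 2) ->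
  \sum_(k <= i < n) sigma2 i <= s ^+ 2 * (n - k)%:R.
Proof.
move=> k0 kn Hs; rewrite mulr_natr -sumr_const_nat.
apply: ler_sum_nat => i /andP[ki _]; apply: Hs; exact: leq_trans ki.
Qed.

Lemma measurable_psum_index (F : T -> nat) : (forall n, measurable (F @^-1` [set n])) ->
  measurable_fun setT (fun t => S 1 (F t).+1 t).
Proof.
move=> mF; apply: (measurable_fun_nat_index mF (F := fun n t => S 1 n.+1 t)) => n.
exact: measurable_psum.
Qed.

(** On {N = n, M = m} the difference is a sum of |n - m| centered terms independent of the indices,
    with standard deviation at most s |n - m|^(1/2). *)
Lemma integral_psum_dist_le (s : R) : 0 < s ->
  (forall i, (1 <= i)%N -> sigma2 i <= s ^+ 2) ->
  (\int[P]_t (`|S 1 (N t).+1 t - S 1 (M t).+1 t|)%:E <=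
   s%:E * \int[P]_t (Num.sqrt `|(N t)%:R - (M t)%:R|)%:E)%E.
Proof.
move=> s0 Hs.
have mD : measurable_fun setT (fun t => Num.sqrt `|(N t)%:R - (M t)%:R| : R).
  apply: (measurable_fun_nat_index mN
    (F := fun n t => Num.sqrt `|n%:R - (M t)%:R| : R)) => n.
  by apply: (measurable_fun_nat_index mM (F := fun m t => Num.sqrt `|n%:R - m%:R| : R)).
rewrite -ge0_integralZl//; try by [exact/measurable_EFinP |
  move=> t _; rewrite lee_fin sqrtr_ge0 | rewrite lee_fin ltW].
(* The pair (N, M) is coded as one integer, so that the comparison by levels applies. *)
pose Z t := choice.pickle (N t, M t).
have ZE k : Z @^-1` [set k] = NM @^-1` [set x | choice.pickle x = k] by [].
apply: (@le_integral_levels _ _ _ P Z).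
- by move=> k; rewrite ZE.
- apply/measurable_EFinP; apply: measurableT_comp => //.
  by apply: measurable_funB; exact: measurable_psum_index.
- by apply: emeasurable_funM => //; exact/measurable_EFinP.
- by move=> t; rewrite lee_fin.
- by move=> t; rewrite mule_ge0// lee_fin ?sqrtr_ge0// ltW.
move=> k; rewrite ZE.
have [[[n m] nmk]|nok] := pselect (exists x : nat * nat, choice.pickle x = k); last first.
  rewrite (_ : _ @^-1` _ = set0) ?integral_set0//.
  by apply/seteqP; split => t //= Zt; apply: nok; exists (N t, M t).
have NMt t : (NM @^-1` [set x | choice.pickle x = k]) t -> N t = n /\ M t = m.
  by move=> /=; rewrite -nmk => /(pcan_inj choice.pickleK)[].
rewrite (eq_integral (fun t => (`|S (minn n m).+1 (maxn n m).+1 t|)%:E)); last first.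
  by move=> t /set_mem/NMt[-> ->]; rewrite psum_dist.
rewrite [leRHS](eq_integral (cst (s * Num.sqrt `|n%:R - m%:R|)%:E)); last first.
  by move=> t /set_mem/NMt[-> ->]; rewrite EFinM.
rewrite integral_cst// index_psum_integral// muleC.
(* The diagonal is separate because the moment bound needs r > 0. *)
have [->|nm] := eqVneq n m.
  rewrite minnn maxnn psum_geq//; under eq_integral do rewrite /= normr0.
  by rewrite integral0 mul0e mule_ge0// lee_fin mulr_ge0 ?sqrtr_ge0// ltW.
apply: lee_wpmul2r => //; rewrite nat_dist.
have nm' := minn_lt_maxn nm.
apply: integral_psum_norm_le => //.
  by rewrite mulr_gt0// sqrtr_gt0 ltr0n subn_gt0.
rewrite exprMn sqr_sqrtr ?ler0n// -(subSS (minn n m)).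
by apply: sum_sigma2_le => //; rewrite ltnS ltnW.
Qed.

(** For N = n, the choice r = 1 + (sum of the variances) satisfies r^2 >= sum, so E|S_n| <= r. The
    mean of this r over N is finite by hypothesis. *)
Lemma integrable_psum_index :
  (\int[P]_t (\sum_(1 <= i < (N t).+1) sigma2 i)%:E < +oo)%E ->
  P.-integrable setT (EFin \o (fun t => S 1 (N t).+1 t)).
Proof.
move=> Sfin.
have s0 i j : (0 < i)%N -> 0 <= \sum_(i <= k < j) sigma2 k.
  move=> i0; rewrite big_nat; apply: sumr_ge0 => k /andP[ik _].
  by have [/ltW] := X2 (leq_trans i0 ik).
have mS : measurable_fun setT (fun t => \sum_(1 <= i < (N t).+1) sigma2 i).
  exact: (measurable_fun_nat_index mN (F := fun n _ => \sum_(1 <= i < n.+1) sigma2 i)).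
apply/integrableP; split; first by apply/measurable_EFinP; exact: measurable_psum_index.
apply: (@le_lt_trans _ _ (\int[P]_t (1 + (\sum_(1 <= i < (N t).+1) sigma2 i)%:E))%E); last first.
  rewrite ge0_integralD//; last 2 first.
  - by move=> t _; rewrite lee_fin s0.
  - exact/measurable_EFinP.
  by rewrite probability_integral_cst lte_add_pinfty// ltry.
apply: (le_integral_levels mN).
- apply/measurable_EFinP; apply: measurableT_comp => //; exact: measurable_psum_index.
- by apply: emeasurable_funD => //; exact/measurable_EFinP.
- by move=> t /=; rewrite lee_fin.
- by move=> t; rewrite adde_ge0// lee_fin s0.
move=> n.
rewrite (eq_integral (fun t => (`|S 1 n.+1 t|)%:E)); last by move=> t /set_mem /= ->.
rewrite [leRHS](eq_integral (cst (1 + \sum_(1 <= i < n.+1) sigma2 i)%:E)); last first.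
  by move=> t /set_mem /= ->; rewrite EFinD.
rewrite integral_cst// -[X in integral _ X _]/(NM @^-1` [set x | x.1 = n]).
rewrite index_psum_integral// muleC; apply: lee_wpmul2r => //.
have sn := s0 1%N n.+1 isT.
apply: integral_psum_norm_le => //; first by rewrite ltr_pwDl.
by rewrite sqrrD expr1n mul1r -mulr_natl; have := sqr_ge0 (\sum_(1 <= i < n.+1) sigma2 i); lra.
Qed.

End moments.

(** * From quantile distance to shifted tails *)

Section quantile.
Context {d : measure_display} {T : measurableType d} {R : realType}.
Variable P : probability T R.

Let cdf_le (X : T -> R) : measurable_fun setT X ->
  {homo Defs.cdf P X : x y / x <= y}.
Proof.
move=> mX x y xy.
have mle z : measurable [set t | X t <= z].
  rewrite -[X in measurable X]setTI; apply: (mX measurableT [set r | r <= z]).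
  by rewrite -set_itvNyc.
rewrite /Defs.cdf fine_le ?fin_num_measure//.
apply: le_measure; [apply/mem_set; exact: mle|apply/mem_set; exact: mle|].
by move=> t /= /le_trans; apply.
Qed.

(** The limits 0 and 1 make the set defining a quantile at a level in ]0, 1[ bounded below and
    nonempty, so [inf] does not fall back on its default value. *)
Let cdf_cvg (X : T -> R) : measurable_fun setT X ->
  (forall v, 0 < v -> exists z, forall x, x < z -> Defs.cdf P X x < v) /\
  (forall v, v < 1 -> exists x, v < Defs.cdf P X x).
Proof.
move=> mX.
pose X' : {RV P >-> R} := HB.pack X (isMeasurableFun.Build _ _ _ _ _ mX).
have E : (fun x => fine (random_variable.cdf X' x)) = Defs.cdf P X.
  apply/funext => x; rewrite /random_variable.cdf /distribution /pushforward /Defs.cdf.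
  by congr (fine (P _)); apply/seteqP; split => t /=; rewrite in_itv.
have L0 : Defs.cdf P X x @[x --> -oo%R] --> (0 : R).
  by rewrite -E; apply: fine_cvg; exact: cvg_cdfNy0.
have L1 : Defs.cdf P X x @[x --> +oo%R] --> (1 : R).
  by rewrite -E; apply: fine_cvg; exact: cvg_cdfy1.
split.
  move=> v v0; have := cvgr_lt _ L0 _ v0.
  by move=> [z [_ Hz]]; exists z => x /Hz.
move=> v v1; have := cvgr_gt _ L1 _ v1.
move=> [z [_ Hz]]; exists (z + 1); by apply: Hz; rewrite ltrDl ltr01.
Qed.

(** If the inequality failed, a level v strictly between the two values would have its X-quantile at
    most x, hence its Y-quantile at most x + q. The slack e lets a point near the infimum replace
    the quantile itself, without right-continuity. *)
Lemma qinv_cdf_le (X Y : T -> R) (q e x : R) :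
  measurable_fun setT X -> measurable_fun setT Y -> 0 < e ->
  (forall u, 0 < u < 1 -> `|qinv P X u - qinv P Y u| <= q) ->
  (P [set t | X t <= x]%R <= P [set t | Y t <= x + q + e]%R)%E.
Proof.
move=> mX mY e0 Hq.
have mle (Z : T -> R) z : measurable_fun setT Z -> measurable [set t | Z t <= z].
  move=> mZ; rewrite -[X in measurable X]setTI; apply: (mZ measurableT [set r | r <= z]).
  by rewrite -set_itvNyc.
suff : Defs.cdf P X x <= Defs.cdf P Y (x + q + e).
  by rewrite -lee_fin /Defs.cdf !fineK ?fin_num_measure//; exact: mle.
rewrite leNgt; apply/negP => lt.
(* The midpoint of a value >= 0 and a strictly larger value <= 1 lies in ]0, 1[, where the quantile
   hypothesis holds. *)
pose v := (Defs.cdf P X x + Defs.cdf P Y (x + q + e)) / 2.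
have Y0 : 0 <= Defs.cdf P Y (x + q + e) by rewrite /Defs.cdf fine_ge0.
have X1 : Defs.cdf P X x <= 1.
  rewrite -lee_fin /Defs.cdf fineK ?fin_num_measure//; last exact: mle.
  by apply: probability_le1; exact: mle.
have [vX Yv] : v < Defs.cdf P X x /\ Defs.cdf P Y (x + q + e) < v by rewrite /v; split; lra.
have v01 : 0 < v < 1 by rewrite /v; lra.
have lb (Z : T -> R) : measurable_fun setT Z -> has_lbound [set y | v <= Defs.cdf P Z y].
  move=> mZ; have [|z Hz] := (cdf_cvg mZ).1 v; first by case/andP: v01.
  by exists z => y /= vy; rewrite leNgt; apply/negP => /Hz; rewrite ltNge vy.
have qX : qinv P X v <= x by apply: (ge_inf (lb _ mX)); exact: ltW.
have qY : qinv P Y v <= x + q.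
  have := Hq _ v01; rewrite ler_norml => /andP[? ?]; lra.
have hi : has_inf [set y | v <= Defs.cdf P Y y].
  split; last exact: lb.
  by have [|y vy] := (cdf_cvg mY).2 v; [case/andP: v01|exists y; exact: ltW].
have [y /= vy yx] := inf_adherent e0 hi.
have : Defs.cdf P Y y <= Defs.cdf P Y (x + q + e).
  by apply: cdf_le => //; rewrite ltW// (lt_le_trans yx)// lerD2r.
by rewrite leNgt (lt_le_trans Yv).
Qed.

End quantile.

Lemma eq_indic {R : pzRingType} {T1 T2 : Type} (A : set T1) (B : set T2) x y :
  (A x <-> B y) -> \1_A x = \1_B y :> R.
Proof.
move=> [AB BA]; rewrite !indicE; congr ((nat_of_bool _)%:R).
by apply/idP/idP => /set_mem ?; apply/mem_set; auto.
Qed.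

(** * Comparison of the last term under a random index *)

Section last_term.
Context {d : measure_display} {T : measurableType d} {R : realType}.
Variables (P : probability T R) (N M : T -> nat) (X XL : nat -> T -> R).
Hypotheses (mN : forall n, measurable (N @^-1` [set n]))
  (mM : forall n, measurable (M @^-1` [set n]))
  (mX : forall i, measurable_fun setT (X i))
  (mXL : forall i, measurable_fun setT (XL i)).
Hypothesis ind : mutually_independent P (fun o : option nat => match o with
     | None => sigma_pair_nat N M
     | Some i => sigma_pair_R (X i.+1) (XL i.+1)
     end).

Local Notation S := (psum X).
Local Notation NM := (fun t => (N t, M t)).

Hypothesis M1 : forall t, (1 <= M t)%N.

(** On {M = m} and given S_(m-1), the inequality is the hypothesis at level x - S_(m-1). With [fst]
    and [snd] for f1 and f2, in either order, it serves both directions. *)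
Lemma last_term_compare (f1 f2 : R * R -> R) (q x : R) :
  measurable_fun setT f1 -> measurable_fun setT f2 ->
  (forall m y, (1 <= m)%N -> P [set t | f1 (X m t, XL m t) <= y]%R <=
     P [set t | f2 (X m t, XL m t) <= y + q]%R)%E ->
  (P [set t | S 1 (M t) t + f1 (X (M t) t, XL (M t) t) <= x]%R <=
   P [set t | S 1 (M t) t + f2 (X (M t) t, XL (M t) t) <= x + q]%R)%E.
Proof.
move=> mf1 mf2 H.
have mVm m : measurable_fun setT (fun t => (X m t, XL m t)) by exact: measurable_fun_pair.
have mle y : measurable [set r : R | r <= y] by rewrite -set_itvNyc.
have mf (f : R * R -> R) m : measurable_fun setT f ->
    measurable_fun setT (fun t => S 1 m t + f (X m t, XL m t)).
  move=> mf'; apply: measurable_funD; first exact: measurable_psum.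
  exact: (measurableT_comp mf' (mVm m)).
have mset (f : R * R -> R) y : measurable_fun setT f ->
    measurable [set t | S 1 (M t) t + f (X (M t) t, XL (M t) t) <= y].
  move=> mf'; rewrite -[X in measurable X]setTI.
  apply: (measurable_fun_nat_index mM
    (F := fun m t => S 1 m t + f (X m t, XL m t)) _ measurableT (mle y)).
  by move=> m; exact: mf.
have mV m : measurable (M @^-1` [set m]) by exact: mM.
rewrite -[X in (P X <= _)%E]setIT -[X in (_ <= P X)%E]setIT.
rewrite -!integral_indic//; try exact: mset.
apply: (le_integral_levels mM) => //.
- by apply/measurable_EFinP; apply: measurable_indic; exact: mset.
- by apply/measurable_EFinP; apply: measurable_indic; exact: mset.
(* The level M = 0 is empty since M >= 1. *)
case=> [|m].
  rewrite (_ : M @^-1` [set 0%N] = set0) ?integral_set0//.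
  by apply/seteqP; split => t //= Mt; have := M1 t; rewrite Mt.
have red (f : R * R -> R) y : measurable_fun setT f ->
    (\int[P]_(t in M @^-1` [set m.+1])
      (\1_[set t | S 1 (M t) t + f (X (M t) t, XL (M t) t) <= y]%R t)%:E =
     \int[P]_(t in M @^-1` [set m.+1]) P [set s | f (X m.+1 s, XL m.+1 s) <= y - S 1 m.+1 t]%R)%E
    /\ measurable_fun setT (fun t => P [set s | f (X m.+1 s, XL m.+1 s) <= y - S 1 m.+1 t]%R).
  move=> mf'.
  pose g (x : R * (R * R)) : \bar R := (\1_[set r | r <= y] (x.1 + f x.2))%:E.
  have mg : measurable_fun setT g.
    apply/measurable_EFinP; apply: measurableT_comp; first exact: measurable_indic.
    by apply: measurable_funD => //; exact: measurableT_comp.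
  have g0 z : (0 <= g z)%E by rewrite lee_fin.
  have gE u : (\int[P]_s g (u, (X m.+1 s, XL m.+1 s)) =
      P [set s | f (X m.+1 s, XL m.+1 s) <= y - u]%R)%E.
    rewrite -[X in P X]setIT -integral_indic//.
      by apply: eq_integral => s _; congr EFin; apply: eq_indic => /=; rewrite lerBrDl.
    rewrite -[X in measurable X]setTI.
    exact: (measurableT_comp mf' (mVm m.+1) measurableT (mle _)).
  have := @ge0_indep_integral _ _ _ P _ _ _ _ (NM @^-1` [set x | x.2 = m.+1]) (S 1 m.+1)
    (fun t => (X m.+1 t, XL m.+1 t)) (mM m.+1) (measurable_psum mX 1 m.+1) (mVm m.+1)
    (fun B D => @index_psum_pair_indep _ _ _ P N M X XL mN mM mX mXL ind _ 1 m.+1 B D isT isT)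
    g mg g0.
  move=> Hg; split.
    transitivity (\int[P]_(t in NM @^-1` [set x | x.2 = m.+1]) g (S 1 m.+1 t, (X m.+1 t, XL m.+1 t)))%E.
      by apply: eq_integral => t /set_mem /= Mt; congr EFin; apply: eq_indic; rewrite /= Mt.
    by rewrite Hg; apply: eq_integral => t _; rewrite gE.
  under eq_fun do rewrite -gE.
  have := ge0_indep_measurable P (mVm m.+1) mg g0.
  by move=> /measurableT_comp; apply; exact: measurable_psum.
have [-> m1] := red f1 x mf1; have [-> m2] := red f2 (x + q) mf2.
apply: ge0_le_integral => //; [exact: measurable_funTS|exact: measurable_funTS|].
by move=> t _; rewrite (le_trans (H m.+1 _ isT))// addrAC.
Qed.

End last_term.

(** * Almost sure statements *)

Section almost_everywhere.
Context {d : measure_display} {T : measurableType d} {R : realType}.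
Variable P : probability T R.

(** The whole space is not a null set. This turns an almost sure statement about constants into a
    plain one. *)
Lemma ae_exists (Q : T -> Prop) : {ae P, forall t, Q t} -> exists t, Q t.
Proof.
move=> [A [mA PA QA]]; apply: contrapT => nQ.
have AT : A = setT.
  by apply/seteqP; split => // t _; apply: QA => /= Qt; apply: nQ; exists t.
have : P setT = 1%E by exact: probability_setT.
by rewrite -AT PA => /eqP; rewrite eq_sym onee_eq0.
Qed.

Lemma ae_le_measure (A B : set T) : measurable A -> measurable B ->
  {ae P, forall t, A t -> B t} -> (P A <= P B)%E.
Proof.
move=> mA mB [C [mC PC ABC]].
apply: (@le_trans _ _ (P (B `|` C))).
  apply: le_measure; [exact/mem_set|apply/mem_set; exact: measurableU|].
  move=> t At; have [Bt|nBt] := pselect (B t); [by left|right].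
  by apply: ABC => /= /(_ At).
apply: (le_trans (measureU2 _ mB mC)); rewrite -[leRHS]adde0; apply: leeD2l.
by move/eqP: PC; rewrite eq_le => /andP[].
Qed.

End almost_everywhere.

(** * Kolmogorov bound for the random sum *)

Section kolmogorov.
Context {d : measure_display} {T : measurableType d} {R : realType}.
Variables (P : probability T R) (N M : T -> nat) (X XL : nat -> T -> R).
Hypotheses (mN : forall n, measurable (N @^-1` [set n]))
  (mM : forall n, measurable (M @^-1` [set n]))
  (mX : forall i, measurable_fun setT (X i))
  (mXL : forall i, measurable_fun setT (XL i)).
Hypothesis ind : mutually_independent P (fun o : option nat => match o with
     | None => sigma_pair_nat N M
     | Some i => sigma_pair_R (X i.+1) (XL i.+1)
     end).

Local Notation S := (psum X).
Local Notation NM := (fun t => (N t, M t)).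

Hypothesis M1 : forall t, (1 <= M t)%N.
Variables (a b q k : R).
Hypotheses (a0 : 0 < a) (b0 : 0 < b) (q0 : 0 <= q) (k0 : 0 <= k)
  (st : laplace_stein P b (fun t => a * S 1 (N t).+1 t) (stein_sum M X XL a))
  (Hk : {ae P, forall t, `|S 1 (N t).+1 t - S 1 (M t).+1 t| <= k})
  (HXL : forall e m y, 0 < e -> (1 <= m)%N ->
     (P [set t | X m t <= y]%R <= P [set t | XL m t <= y + q + e]%R)%E)
  (HLX : forall e m y, 0 < e -> (1 <= m)%N ->
     (P [set t | XL m t <= y]%R <= P [set t | X m t <= y + q + e]%R)%E).

Let mle y : measurable [set r : R | r <= y].
Proof. by rewrite -set_itvNyc. Qed.

Let mlt y : measurable [set r : R | r < y].
Proof. by rewrite -set_itvNyo. Qed.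

Let mpre (V : T -> R) (B : set R) : measurable_fun setT V -> measurable B ->
  measurable (V @^-1` B).
Proof. by move=> mV mB; rewrite -[X in measurable X]setTI; exact: mV. Qed.

Let WL := stein_sum M X XL a.

Let mWL : measurable_fun setT WL.
Proof. exact: measurable_stein_sum. Qed.

Let mW : measurable_fun setT (fun t => a * S 1 (N t).+1 t).
Proof. by apply: measurable_funM => //; exact: measurable_psum_index. Qed.

Let mSXL : measurable_fun setT (fun t => S 1 (M t) t + XL (M t) t).
Proof.
apply: (measurable_fun_nat_index mM (F := fun n t => S 1 n t + XL n t)) => n.
by apply: measurable_funD => //; exact: measurable_psum.
Qed.

(** The tail of W is moved to that of W^L through S_M: replacing S_N by S_M shifts by k, replacing
    X_M by X_M^L shifts by q plus a slack, and everything is scaled by a. The slack is removed by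
    letting eta tend to 0. *)
Lemma random_sum_kolmogorov x :
  (`| P [set t | (a * S 1 (N t).+1 t <= x)%R] -
    \int[lebesgue_measure]_(y in [set y : R | (y <= x)%R]) (laplace_pdf b y)%:E | <=
   (2 * (a * (q + k)) / b)%:E)%E.
Proof.
apply/lee_addgt0Pr => eta eta0.
(* Chosen so that the extra 2e inside D contributes 2a(2e)/b = eta. *)
pose e := eta * b / (4 * a).
have e0 : 0 < e by rewrite divr_gt0 ?mulr_gt0.
(* One e pays for the slack in the quantile comparison, the other for the strict inequality on the
   right. *)
pose D := a * (q + k + 2 * e).
have D0 : 0 < D by rewrite mulr_gt0// ltr_wpDl ?addr_ge0// mulr_gt0.
have -> : ((2 * (a * (q + k)) / b)%:E + eta%:E = (2 * D / b)%:E)%E.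
  rewrite -EFinD; congr EFin; rewrite /D /e; field.
  by rewrite !gt_eqF.
apply: (kolmogorov_stein b0 mW mWL st x D0) => z.
  have H1 : (P [set t | a * S 1 (N t).+1 t <= z]%R <= P [set t | S 1 (M t).+1 t <= z / a + k]%R)%E.
    apply: ae_le_measure.
    - exact: (mpre mW (mle z)).
    - exact: (mpre (measurable_psum_index mX mM) (mle _)).
    apply: filterS Hk => t; rewrite ler_norml => /andP[Hl Hr] /= Wz.
    have : S 1 (N t).+1 t <= z / a by rewrite ler_pdivlMr// mulrC.
    by move=> ?; lra.
  rewrite (le_trans H1)//.
  have H2 := @last_term_compare _ _ _ P N M X XL mN mM mX mXL ind M1 fst snd (q + e) (z / a + k)
    measurable_fst measurable_snd.
  apply: (@le_trans _ _ (P [set t | S 1 (M t) t + XL (M t) t <= z / a + k + (q + e)])).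
    under [X in (P X <= _)%E]eq_set => t do rewrite psumS//.
    by apply: H2 => m y m1 /=; rewrite addrA; exact: HXL.
  apply: le_measure.
  - by apply/mem_set; exact: (mpre mSXL (mle _)).
  - by apply/mem_set; exact: (mpre mWL (mlt _)).
  move=> t /= Ht; rewrite /WL /stein_sum.
  rewrite (le_lt_trans (ler_wpM2l (ltW a0) Ht))//.
  have -> : a * (z / a + k + (q + e)) = z + a * (q + k + e) by field; rewrite gt_eqF.
  by rewrite ltrD2l /D ltr_pM2l// ltrD2l; lra.
have H2 := @last_term_compare _ _ _ P N M X XL mN mM mX mXL ind M1 snd fst (q + e) (z / a)
  measurable_snd measurable_fst.
apply: (@le_trans _ _ (P [set t | S 1 (M t) t + XL (M t) t <= z / a])).
  apply: le_measure.
  - by apply/mem_set; exact: (mpre mWL (mle _)).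
  - by apply/mem_set; exact: (mpre mSXL (mle _)).
  by move=> t /=; rewrite /WL /stein_sum ler_pdivlMr// mulrC.
apply: (@le_trans _ _ (P [set t | S 1 (M t).+1 t <= z / a + (q + e)])).
  under [X in (_ <= P X)%E]eq_set => t do rewrite psumS//.
  by apply: H2 => m y m1 /=; rewrite addrA; exact: HLX.
apply: ae_le_measure.
- exact: (mpre (measurable_psum_index mX mM) (mle _)).
- exact: (mpre mW (mlt _)).
apply: filterS Hk => t; rewrite ler_norml => /andP[Hl Hr] /= Wz.
have : S 1 (N t).+1 t <= z / a + (q + k + e) by lra.
move=> /(ler_wpM2l (ltW a0)) /le_lt_trans; apply.
have -> : a * (z / a + (q + k + e)) = z + a * (q + k + e) by field; rewrite gt_eqF.
by rewrite ltrD2l /D ltr_pM2l// ltrD2l; lra.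
Qed.

End kolmogorov.

(** * Assembly of the three bounds *)

Unset Implicit Arguments.

Theorem theorem5p9 (d : measure_display) (T : measurableType d) (R : realType)
  (P : probability T R) (N M : T -> nat) (X XL : nat -> T -> R) (sigma2 : nat -> R) :
  (forall n, measurable (N @^-1` [set n])) ->
  (forall n, measurable (M @^-1` [set n])) ->
  (forall i, measurable_fun setT (X i)) ->
  (forall i, measurable_fun setT (XL i)) ->
  (* N and M are positive integer-valued *)
  (forall t, (1 <= N t)%N) -> (forall t, (1 <= M t)%N) ->
  (* mu = E N < oo *)
  (\int[P]_t ((N t)%:R)%:E < +oo)%E ->
  (* E X_i = 0 *)
  (forall i, (1 <= i)%N ->
     P.-integrable setT (EFin \o X i) /\ (\int[P]_t (X i t)%:E = 0)%E) ->
  (* E X_i^2 = sigma_i^2 in (0, oo) *)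
  (forall i, (1 <= i)%N ->
     0 < sigma2 i /\ (\int[P]_t (X i t ^+ 2)%:E = (sigma2 i)%:E)%E) ->
  let mu : R := fine (\int[P]_t ((N t)%:R)%:E)%E in
  let S : \bar R := (\int[P]_t (\sum_(1 <= i < (N t).+1) sigma2 i)%:E)%E in
  (S < +oo)%E ->
  (* sigma^2 = mu^-1 E [ sum_{i=1}^N sigma_i^2 ] *)
  let s2 : R := fine S / mu in
  (* law of M *)
  (forall m, (1 <= m)%N ->
     P (M @^-1` [set m]) = ((sigma2 m / (mu * s2))%:E * P [set t | (m <= N t)%N])%E) ->
  (* X_i^L has the X_i-centered equilibrium distribution *)
  (forall i, (1 <= i)%N -> equilibrium P (X i) (XL i)) ->
  (* (N,M), (X_1,X_1^L), (X_2,X_2^L), ... are mutually independent *)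
  mutually_independent P (fun o : option nat =>
     match o with
     | None => sigma_pair_nat N M
     | Some i => sigma_pair_R (X i.+1) (XL i.+1)
     end) ->
  let W : T -> R := fun t => (Num.sqrt mu)^-1 * \sum_(1 <= i < (N t).+1) X i t in
  let b : R := Num.sqrt s2 / Num.sqrt 2 in
  let supsig : \bar R :=
    ereal_sup [set (Num.sqrt (sigma2 i))%:E | i in [set i : nat | (1 <= i)%N]] in
  let supq : \bar R :=
    ereal_sup [set qdist P (X i) (XL i) | i in [set i : nat | (1 <= i)%N]] in
  let c17 : R := (1704%:R / 100%:R) / (Num.sqrt s2 * Num.sqrt mu) in
  [/\ (wasserstein_laplace P W b
        <= (12 * (Num.sqrt mu)^-1)%:E *
           (\int[P]_t (`|X (M t) t - XL (M t) t|)%:E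
            + supsig * \int[P]_t (Num.sqrt `|(N t)%:R - (M t)%:R|)%:E))%E,
      (forall C K : R,
         (forall i, (1 <= i)%N -> {ae P, forall t, `|X i t| <= C}) ->
         {ae P, forall t, `|(N t)%:R - (M t)%:R| <= K} ->
         (kolmogorov_laplace P W b <= c17%:E * (supq + (C * K)%:E))%E)
    & ({ae P, forall t, N t = M t} ->
         (kolmogorov_laplace P W b <= c17%:E * supq)%E)].
Proof.
move=> mN mM mX mXL N1 M1 Nfin X1 X2 mu S Sfin s2 lawM eqX ind W b supsig supq c17.
have mNR : measurable_fun setT (fun t => (N t)%:R : R).
  exact: (measurable_fun_nat_index mN (F := fun n _ => n%:R : R)).
have muE : (\int[P]_t ((N t)%:R)%:E = mu%:E)%E.
  by rewrite /mu fineK// ge0_fin_numE//; apply: integral_ge0 => t _; rewrite lee_fin.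
have mu0 : 0 < mu.
  rewrite -lte_fin -muE (lt_le_trans (y := 1%E))// -(probability_integral_cst P 1).
  apply: ge0_le_integral => //; first exact/measurable_EFinP.
  by move=> t _; rewrite lee_fin ler1n.
have sig0 i : (1 <= i)%N -> 0 < sigma2 i by move=> /X2[].
have mS : measurable_fun setT (fun t => \sum_(1 <= i < (N t).+1) sigma2 i).
  exact: (measurable_fun_nat_index mN (F := fun n _ => \sum_(1 <= i < n.+1) sigma2 i)).
have Sge t : sigma2 1%N <= \sum_(1 <= i < (N t).+1) sigma2 i.
  rewrite big_ltn ?ltnS ?N1// lerDl big_nat; apply: sumr_ge0 => i /andP[i2 _].
  by rewrite ltW// sig0// ltnW.
(* Since N >= 1, the expected sum of variances is at least sigma_1^2, so s2 and the scale b are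
   positive. *)
have S1 : ((sigma2 1%N)%:E <= S)%E.
  rewrite -(probability_integral_cst P) /S.
  apply: ge0_le_integral => //.
  - by move=> t _; rewrite lee_fin ltW// sig0.
  - exact/measurable_EFinP.
  - by move=> t _; rewrite lee_fin.
have SE : S = (fine S)%:E.
  by rewrite fineK// ge0_fin_numE// (le_trans _ S1)// lee_fin ltW// sig0.
have v0 : 0 < fine S by rewrite -lte_fin -SE (lt_le_trans _ S1)// lte_fin sig0.
have s20 : 0 < s2 by rewrite divr_gt0.
have vE : mu * s2 = fine S by rewrite /s2 mulrC divfK// gt_eqF.
have lawM' m : (1 <= m)%N ->
    sigma2 m * fine (P [set t | (m <= N t)%N]) = fine S * fine (P (M @^-1` [set m])).
  move=> m1; rewrite (lawM m m1) vE fineM//; last first.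
    by apply: fin_num_measure; exact: (measurable_preimage_nat mN [set k | (m <= k)%N]).
  by rewrite /= mulrA; congr (_ * _); rewrite mulrCA divff ?mulr1// gt_eqF.
pose a := (Num.sqrt mu)^-1.
have a0 : 0 < a by rewrite invr_gt0 sqrtr_gt0.
have b0 : 0 < b by rewrite divr_gt0// sqrtr_gt0.
(* b^2 is s2/2, and s2 = v/mu = v a^2 for v the expected sum of variances. *)
have bE : b ^+ 2 = 2^-1 * fine S * a ^+ 2.
  rewrite /b /a expr_div_n !sqr_sqrtr// ?ltW// exprVn sqr_sqrtr ?ltW// -vE.
  by field; rewrite gt_eqF.
have X2' i : (1 <= i)%N -> (\int[P]_t (X i t ^+ 2)%:E = (sigma2 i)%:E)%E by move=> /X2[].
have st := laplace_stein_sum mN mM mX mXL ind X2' eqX M1 lawM' b0 bE.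
pose WL := stein_sum M X XL a.
have mWL : measurable_fun setT WL by exact: measurable_stein_sum.
have mSN : measurable_fun setT (fun t => psum X 1 (N t).+1 t) by exact: measurable_psum_index.
have mSM : measurable_fun setT (fun t => psum X 1 (M t).+1 t) by exact: measurable_psum_index.
have mW : measurable_fun setT W by exact: measurable_funM.
have mXM : measurable_fun setT (fun t => X (M t) t) by exact: measurable_fun_nat_index.
have mXLM : measurable_fun setT (fun t => XL (M t) t) by exact: measurable_fun_nat_index.
have mSNM : measurable_fun setT (fun t => (`|psum X 1 (N t).+1 t - psum X 1 (M t).+1 t|)%:E : \bar R).
  by apply/measurable_EFinP; apply: measurableT_comp => //; exact: measurable_funB.
have mDM : measurable_fun setT (fun t => (`|X (M t) t - XL (M t) t|)%:E : \bar R).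
  by apply/measurable_EFinP; apply: measurableT_comp => //; exact: measurable_funB.
have [mD D0] : measurable_fun setT (fun t => (Num.sqrt `|(N t)%:R - (M t)%:R|)%:E : \bar R) /\
    forall t, (0 <= (Num.sqrt `|(N t)%:R - (M t)%:R|)%:E :> \bar R)%E.
  split; last by move=> t; rewrite lee_fin sqrtr_ge0.
  apply/measurable_EFinP; apply: (measurable_fun_nat_index mN
    (F := fun n t => Num.sqrt `|n%:R - (M t)%:R| : R)) => n.
  exact: (measurable_fun_nat_index mM (F := fun m t => Num.sqrt `|n%:R - m%:R| : R)).
(* From the numeral 17.04 only w >= 4 is kept, enough for 2 sqrt 2; the constant is then made
   opaque. *)
have [w [w4 c17E]] : exists w : R, 4 <= w /\ c17 = w / (Num.sqrt s2 * Num.sqrt mu).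
  exists (1704%:R / 100%:R); split; last exact: erefl.
  by rewrite ler_pdivlMr ?ltr0n// -natrM ler_nat.
clearbody c17.
have c170 : 0 < c17.
  by rewrite c17E divr_gt0 ?(lt_le_trans _ w4)// mulr_gt0// sqrtr_gt0.
have qd_ge0 i : (1 <= i)%N -> (0 <= qdist P (X i) (XL i))%E.
  move=> i1; apply: (@le_trans _ _ (`|qinv P (X i) 2^-1 - qinv P (XL i) 2^-1|)%:E).
    by rewrite lee_fin.
  by apply: ereal_sup_ubound; exists 2^-1 => //=; rewrite in_itv/=; lra.
have supq0 : (0 <= supq)%E.
  by apply: (le_trans (qd_ge0 1%N isT)); apply: ereal_sup_ubound; exists 1%N.
(* Both Kolmogorov assertions come from this with a deterministic bound k on |S_N - S_M|: k = C K in
   one, k = 0 in the other. *)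
have kol (q k : R) : supq = q%:E -> 0 <= k ->
    {ae P, forall t, `|psum X 1 (N t).+1 t - psum X 1 (M t).+1 t| <= k} ->
    (kolmogorov_laplace P W b <= (c17 * (q + k))%:E)%E.
  move=> qE k0 Hk.
  have q0 : 0 <= q by rewrite -lee_fin -qE.
  have qd i u : (1 <= i)%N -> 0 < u < 1 -> `|qinv P (X i) u - qinv P (XL i) u| <= q.
    move=> i1 u01; rewrite -lee_fin -qE (le_trans (y := qdist P (X i) (XL i)))//.
      by apply: ereal_sup_ubound; exists u => //=; rewrite in_itv.
    by apply: ereal_sup_ubound; exists i.
  have HXL e m y : 0 < e -> (1 <= m)%N ->
      (P [set t | X m t <= y]%R <= P [set t | XL m t <= y + q + e]%R)%E.
    by move=> e0 m1; apply: qinv_cdf_le => // u; exact: qd.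
  have HLX e m y : 0 < e -> (1 <= m)%N ->
      (P [set t | XL m t <= y]%R <= P [set t | X m t <= y + q + e]%R)%E.
    by move=> e0 m1; apply: qinv_cdf_le => // u; rewrite distrC; exact: qd.
  apply: ge_ereal_sup => _ [x _ <-].
  apply: (le_trans (random_sum_kolmogorov mN mM mX mXL ind M1 a0 b0 q0 k0 st Hk HXL HLX x)).
  rewrite lee_fin c17E /a /b.
  have smu : 0 < Num.sqrt mu by rewrite sqrtr_gt0.
  have ss2 : 0 < Num.sqrt s2 by rewrite sqrtr_gt0.
  have sr2 : 0 < Num.sqrt 2 :> R by rewrite sqrtr_gt0.
  have r2 : Num.sqrt 2 <= 2 :> R.
    have : Num.sqrt 2 ^+ 2 = 2 :> R by rewrite sqr_sqrtr.
    by move: sr2; set r := Num.sqrt 2 => *; nra.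
  have -> : 2 * ((Num.sqrt mu)^-1 * (q + k)) / (Num.sqrt s2 / Num.sqrt 2) =
      2 * Num.sqrt 2 * ((Num.sqrt s2 * Num.sqrt mu)^-1 * (q + k)).
    by field; rewrite !gt_eqF.
  rewrite -[leRHS]mulrA; apply: ler_wpM2r; last by lra.
  by rewrite mulr_ge0 ?addr_ge0// invr_ge0 mulr_ge0// ltW.
split.
- have supge i : (1 <= i)%N -> ((Num.sqrt (sigma2 i))%:E <= supsig)%E.
    by move=> i1; apply: ereal_sup_ubound; exists i.
  have dist : (\int[P]_t (`|psum X 1 (N t).+1 t - psum X 1 (M t).+1 t|)%:E <=
      supsig * \int[P]_t (Num.sqrt `|(N t)%:R - (M t)%:R|)%:E)%E.
    case: supsig supge => [s| |] supge.
    + apply: (@integral_psum_dist_le _ _ _ P N M X XL mN mM mX mXL ind sigma2 X1 X2).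
        by have := supge 1%N isT; rewrite lee_fin; apply: lt_le_trans; rewrite sqrtr_gt0 sig0.
      move=> i i1; have := supge i i1; rewrite lee_fin => si.
      have -> : sigma2 i = Num.sqrt (sigma2 i) ^+ 2 by rewrite sqr_sqrtr// ltW// sig0.
      apply: lerXn2r => //; first exact: sqrtr_ge0.
      by apply: le_trans si; exact: sqrtr_ge0.
    (* Here [supsig] is infinite, and 0 times +oo is 0. If the mean of |N - M|^(1/2) vanishes, then
       N = M almost surely and the left side is 0 as well; otherwise the right side is +oo. *)
    + have [I0|I0] := eqVneq (\int[P]_t (Num.sqrt `|(N t)%:R - (M t)%:R|)%:E)%E 0%E; last first.
        rewrite gt0_mulye ?leey// lt0e I0/=; exact: integral_ge0.
      rewrite I0 mule0.
      pose A := (fun t => (N t, M t)) @^-1` [set x | x.1 != x.2].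
      have mA : measurable A by exact: measurable_preimage_pair_nat.
      have PA : P A = 0%E.
        apply/eqP; rewrite eq_le measure_ge0 andbT -I0 -[X in P X]setIT -integral_indic//.
        apply: ge0_le_integral => //.
        * by apply/measurable_EFinP; exact: measurable_indic.
        move=> t _; rewrite lee_fin indicE; case: (boolP (t \in A)) => [/set_mem /= NM|_]; last first.
          by rewrite sqrtr_ge0.
        rewrite -[leLHS]sqrtr1 ler_sqrt// nat_dist ler1n subn_gt0.
        exact: minn_lt_maxn.
      have mAC : measurable (~` A) by exact: measurableC.
      have -> : (\int[P]_t (`|psum X 1 (N t).+1 t - psum X 1 (M t).+1 t|)%:E =
          \int[P]_(t in A `|` ~` A) (`|psum X 1 (N t).+1 t - psum X 1 (M t).+1 t|)%:E)%E.
        by rewrite setUv.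
      rewrite ge0_integral_setU//; last 2 first.
      * exact: measurable_funTS.
      * by apply/disj_setPS => t /= [].
      rewrite null_set_integral//; last exact: measurable_funTS.
      rewrite add0e integral0_eq// => t /= /negP; rewrite negbK => /eqP /= ->.
      by rewrite subrr normr0.
    + by have := supge 1%N isT.
  have iW : P.-integrable setT (EFin \o W).
    have := integrable_psum_index mN mM mX mXL ind X1 X2 Sfin.
    exact: (integrableZl measurableT a).
  apply: ge_ereal_sup => _ [h hl <-].
  apply: (le_trans (lip1_laplace b0 mW mWL st iW hl)).
  set E1 := (\int[P]_t (`|X (M t) t - XL (M t) t|)%:E)%E.
  set E2 := (supsig * _)%E.
  have E10 : (0 <= E1)%E by apply: integral_ge0.
  have E20 : (0 <= E2)%E.
    by apply: le_trans dist; apply: integral_ge0.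
  (* The estimate holds with 2 in place of 12. *)
  apply: (@le_trans _ _ (2%:E * (a%:E * (E1 + E2)))%E); last first.
    rewrite muleA -EFinM; apply: lee_wpmul2r; first exact: adde_ge0.
    by rewrite lee_fin ler_wpM2r ?ltW//; lra.
  apply: lee_wpmul2l => //.
  apply: (@le_trans _ _ (\int[P]_t (a%:E * ((`|X (M t) t - XL (M t) t|)%:E +
      (`|psum X 1 (N t).+1 t - psum X 1 (M t).+1 t|)%:E)))%E).
    apply: ge0_le_integral => //.
    + by apply/measurable_EFinP; apply: measurableT_comp => //; exact: measurable_funB.
    + by apply: emeasurable_funM => //; exact: emeasurable_funD.
    + move=> t _; rewrite -EFinD -EFinM lee_fin.
      rewrite [X in `|X|](_ : _ = a * ((X (M t) t - XL (M t) t) +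
          (psum X 1 (N t).+1 t - psum X 1 (M t).+1 t))); last first.
        rewrite (psumS X t (M1 t)) /WL /stein_sum /W -/a -/(psum X 1 (N t).+1 t).
        by ring.
      by rewrite normrM (gtr0_norm a0) ler_wpM2l ?(ltW a0)// ler_normD.
  rewrite ge0_integralZl//; last 3 first.
  + exact: emeasurable_funD.
  + by move=> t _; exact: adde_ge0.
  + by rewrite lee_fin ltW.
  apply: lee_wpmul2l; first by rewrite lee_fin ltW.
  rewrite ge0_integralD//; exact: leeD2l.
- move=> C K HC HK.
  have HX : {ae P, forall t, forall i, (1 <= i)%N -> `|X i t| <= C}.
    apply: ae_foralln => i; have [i1|i0] := boolP (1 <= i)%N.
      by apply: filterS (HC i i1) => t.
    exact: aeW.
  have pt t : (forall i, (1 <= i)%N -> `|X i t| <= C) -> `|(N t)%:R - (M t)%:R| <= K ->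
      `|psum X 1 (N t).+1 t - psum X 1 (M t).+1 t| <= C * K /\ 0 <= C * K.
    move=> Xt Kt.
    have C0 : 0 <= C by rewrite (le_trans _ (Xt 1%N isT)).
    have K0 : 0 <= K by rewrite (le_trans _ Kt).
    split; last exact: mulr_ge0.
    apply: (@le_trans _ _ (C * `|(N t)%:R - (M t)%:R|)); last exact: ler_wpM2l.
    rewrite psum_dist nat_dist -(subSS (minn (N t) (M t))) mulr_natr -sumr_const_nat.
    apply: (le_trans (ler_norm_sum _ _ _)); apply: ler_sum_nat => i /andP[i1 _].
    by apply: Xt; exact: leq_trans i1.
  have Hk : {ae P, forall t, `|psum X 1 (N t).+1 t - psum X 1 (M t).+1 t| <= C * K /\ 0 <= C * K}.
    by apply: filterS2 HX HK => t; exact: pt.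
  (* The sign of C K is read off at a single point where the almost sure bounds hold. *)
  have [_ [_ k0]] := ae_exists Hk.
  have {}Hk : {ae P, forall t, `|psum X 1 (N t).+1 t - psum X 1 (M t).+1 t| <= C * K}.
    by apply: filterS Hk => t [].
  case E : supq => [q| |].
  + by rewrite -EFinD -EFinM; exact: kol.
  + by rewrite addye// gt0_muley ?lte_fin// leey.
  + by move: supq0; rewrite E.
- move=> NM.
  case E : supq => [q| |].
  + rewrite -EFinM -[q in X in (_ <= X)%E]addr0; apply: kol => //.
    by apply: filterS NM => t ->; rewrite subrr normr0.
  + by rewrite gt0_muley ?lte_fin// leey.
  + by move: supq0; rewrite E.
Qed.
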